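(* Assume the following hypothesis (the ''eSBM hypothesis'') holds: for all fixed $\delta>0$, integers $k\ge 2$, $d$, and $\eta\in[-\tfrac{1}{k-1},1]$ with $d<d^{\,\mathrm{eq}}_{\mathrm{KS}}(\eta)$ and $k\,|\,(1-\eta)d$, there is no polynomial-time algorithm that distinguishes $\widetilde{\mathcal{G}}^{\,\mathrm{eq}}_{n,d,k,\eta,\delta}$ from $\mathcal{G}_{n,d}$ with high probability as $n\to\infty$. Fix $d>0$ and $k\ge 2$, and let $\eta\in[-\tfrac{1}{k-1},0]$ be such that $|\eta|<\tfrac{2\sqrt{d-1}}{d}$ and $k\,|\,(1-\eta)d$. Then for any $\epsilon>0$, no polynomial-time algorithm can certify the upper bound $nd(|\eta|-\epsilon)$ on $\Gamma_k$ over $\mathcal{G}_{n,d}$. Equivalently, no polynomial-time algorithm can certify, for $\mathbf{G}\sim\mathcal{G}_{n,d}$, the bound $\mathrm{MC}_k(\mathbf{G})\le \frac{k-1}{k}(1+|\eta|-\epsilon)$.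
   Context: All graphs are simple. $\mathcal{G}_{n,d}$ is the uniform distribution on $d$-regular graphs on $n$ vertices. For a graph $G=(V,E)$, $\mathrm{MC}_k(G)=\max_{\sigma:V\to[k]}|\{(u,v)\in E:\sigma(u)\ne\sigma(v)\}|/|E|$. For $\sigma:[n]\to[k]$, its partition matrix $P^{(\sigma)}\in\mathbb{R}^{n\times n}$ has $P_{ij}=1$ if $\sigma(i)=\sigma(j)$ and $-1/(k-1)$ otherwise; $\Gamma_k(A)=\max_\sigma\langle P^{(\sigma)},-A\rangle$. For the adjacency matrix $A_G$ (zero diagonal), $\mathrm{MC}_k(G)=\frac{k-1}{k}(1+\Gamma_k(A_G)/(2|E|))$. A sequence of algorithms $\mathcal{A}_n:\mathbb{R}^{n\times n}\to\mathbb{R}$ certifies the upper bound $B$ on $\Gamma_k$ over a distribution $\mathbb{Q}_n$ if (i) $\mathcal{A}_n(A)\ge\Gamma_k(A)$ for every $A\in\mathbb{R}^{n\times n}$ and (ii) $\mathcal{A}_n(\mathbf{A})\le B$ with probability $1-o(1)$ when $\mathbf{A}\sim\mathbb{Q}_n$ (here $\mathbf{A}=A_{\mathbf G}$, $\mathbf G\sim\mathcal G_{n,d}$); certifying a bound on $\mathrm{MC}_k$ is defined analogously. An algorithm $t_n$ with outputs in $\{\textsc{p},\textsc{q}\}$ distinguishes $\mathbb{P}_n$ and $\mathbb{Q}_n$ with high probability if $\mathbb{P}_n[t_n=\textsc{q}]+\mathbb{Q}_n[t_n=\textsc{p}]=o(1)$. Equitable SBM $\mathcal{G}^{\,\mathrm{eq}}_{n,d,k,\eta}$: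 let $M=\eta I_k+\frac{1-\eta}{k}J_k$ ($J_k$ the all-ones matrix); defined when $k|n$, $dM$ is a nonnegative integer matrix and $dM_{ii}n/k$ is even. Choose a uniformly random balanced $\sigma:[n]\to[k]$ (each class of size $n/k$); on each class $\sigma^{-1}(i)$ place a uniformly random $dM_{ii}$-regular graph, and for each $i<j$ place a uniformly random bipartite graph between $\sigma^{-1}(i)$ and $\sigma^{-1}(j)$ in which every vertex has degree $dM_{ij}$. Noise operator: for a $d$-regular graph $G$ and $\delta>0$, $\mathbf{T}_\delta(G)$ is obtained by performing $\lfloor\delta n\rfloor$ swaps, each of which chooses a pair of distinct edges given as ordered tuples $(i,j),(k,\ell)$ uniformly at random conditioned on $i\ne k$, $j\ne\ell$, $(i,k)\notin E$, $(j,\ell)\notin E$, removes $(i,j),(k,\ell)$ and adds $(i,k),(j,\ell)$. $\widetilde{\mathcal{G}}^{\,\mathrm{eq}}_{n,d,k,\eta,\delta}$ is the law of $\mathbf{T}_\delta(\mathbf{G})$ with $\mathbf{G}\sim\mathcal{G}^{\,\mathrm{eq}}_{n,d,k,\eta}$. $d^{\,\mathrm{eq}}_{\mathrm{KS}}(\eta)=\frac{2}{\eta^2}(1+\sqrt{1-\eta^2})$. Asymptotics are as $n\to\infty$ with $d,k,\eta$ fixed. *)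

(* Defs.v *)
From HB Require Import structures.
From mathcomp Require Import all_boot all_order all_algebra.
From mathcomp Require Import all_classical all_reals all_analysis.

Set Implicit Arguments.
Unset Strict Implicit.
Unset Printing Implicit Defensive.

Import Order.TTheory GRing.Theory Num.Theory.
Import numFieldNormedType.Exports.

Local Open Scope ring_scope.

(** * Deterministic multi-tape Turing machines over {0, 1, blank} *)

(* None is the blank. *)
Definition symbol := option bool.

Variant move := MoveL | MoveR | Stay.

(* A two-way infinite tape: the cells to the left of the head (nearest first),
   and the cells from the head on; all cells not listed are blank. *)
Definition tape : Type := seq symbol * seq symbol.

Definition tape_read (t : tape) : symbol := head None t.2.

Definition tape_write (a : symbol) (t : tape) : tape := (t.1, a :: behead t.2).

Definition tape_move (m : move) (t : tape) : tape :=
  match m with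
  | MoveL => (behead t.1, head None t.1 :: t.2)
  | MoveR => (head None t.2 :: t.1, behead t.2)
  | Stay => t
  end.

(* There are tm_aux.+1 tapes: tape ord0 holds the input and tape ord_max the
   output (they coincide when tm_aux = 0). *)
Record tm := TM {
  tm_aux : nat;
  tm_state : finType;
  tm_start : tm_state;
  tm_halt : pred tm_state;
  tm_trans : tm_state -> {ffun 'I_tm_aux.+1 -> symbol} ->
             tm_state * {ffun 'I_tm_aux.+1 -> symbol * move}
}.

Definition tm_config (M : tm) : Type :=
  tm_state M * {ffun 'I_(tm_aux M).+1 -> tape}.

Definition tm_init (M : tm) (w : seq bool) : tm_config M :=
  (tm_start M,
   [ffun i => if i == ord0 then ([::], map Some w) else ([::], [::])]).

Definition tm_step (M : tm) (c : tm_config M) : tm_config M :=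
  if tm_halt c.1 then c else
  let r := tm_trans c.1 [ffun i => tape_read (c.2 i)] in
  (r.1, [ffun i => tape_move (r.2 i).2 (tape_write (r.2 i).1 (c.2 i))]).

Fixpoint leading_bits (s : seq symbol) : seq bool :=
  if s is Some b :: s' then b :: leading_bits s' else [::].

(* The output is read from the head of the output tape up to the first blank. *)
Definition tm_output (M : tm) (c : tm_config M) : seq bool :=
  leading_bits (c.2 ord_max).2.

Definition tm_computes_within (M : tm) (w : seq bool) (T : nat) (o : seq bool) :
    Prop :=
  let c := iter T (@tm_step M) (tm_init M w) in
  tm_halt c.1 /\ tm_output c = o.

(* One machine for all n, with time polynomial in the length of the encoded
   input. *)
Definition polytime (I : nat -> Type) (O : Type)
    (encI : forall n, I n -> seq bool) (encO : O -> seq bool)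
    (f : forall n, I n -> O) : Prop :=
  exists (M : tm) (c : nat), forall (n : nat) (x : I n),
    tm_computes_within M (encI n x) (c * size (encI n x) ^ c + c)%N
      (encO (f n x)).

(** * Binary encodings *)

(* Least significant bit first, without leading zeros (0 is the empty list). *)
Definition nat_bits (m : nat) : seq bool :=
  mkseq (fun i => odd (m %/ 2 ^ i)%N) (up_log 2 m.+1).

(* Self-delimiting: a 1 before each bit, and a final 0. *)
Definition enc_nat (m : nat) : seq bool :=
  flatten [seq [:: true; b] | b <- nat_bits m] ++ [:: false].

Definition enc_int (z : int) : seq bool := (z < 0) :: enc_nat `|z|%N.

Definition enc_rat (x : rat) : seq bool :=
  enc_int (numq x) ++ enc_nat `|denq x|%N.

Definition enc_mx (n : nat) (X : 'M[rat]_n) : seq bool :=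
  nseq n true ++ false ::
  flatten [seq enc_rat (X i j) | i <- enum 'I_n, j <- enum 'I_n].

(** * Simple graphs on the vertex set 'I_n *)

Definition simple_edges (n : nat) (E : {set {set 'I_n}}) : bool :=
  [forall e in E, #|e| == 2].

Definition sgraph (n : nat) := {E : {set {set 'I_n}} | simple_edges E}.

Definition edges (n : nat) (G : sgraph n) : {set {set 'I_n}} := val G.

Definition adjmx (K : pzRingType) (n : nat) (G : sgraph n) : 'M[K]_n :=
  \matrix_(i, j) ([set i; j] \in edges G)%:R.

Definition enc_graph (n : nat) (G : sgraph n) : seq bool :=
  enc_mx (adjmx rat G).

Definition nbrs (n : nat) (E : {set {set 'I_n}}) (v : 'I_n) : {set 'I_n} :=
  [set u | [set u; v] \in E].

Definition regular (n d : nat) (G : sgraph n) : bool :=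
  [forall v, #|nbrs (edges G) v| == d].

Definition cut_edges (n k : nat) (s : {ffun 'I_n -> 'I_k}) (G : sgraph n) :
    {set {set 'I_n}} :=
  [set e in edges G | [exists u in e, exists v in e, s u != s v]].

(** * Finite probability: mass functions on a finType *)

Definition unif (R : realType) (T : finType) (A : {set T}) (x : T) : R :=
  (x \in A)%:R / #|A|%:R.

Definition Pr (R : realType) (T : finType) (p : T -> R) (E : pred T) : R :=
  \sum_(x | E x) p x.

Definition Gnd (R : realType) (d n : nat) : sgraph n -> R :=
  unif R [set G | regular d G].

Definition Gnd_defined (d : nat) : set nat :=
  [set n | ~~ odd (n * d)%N /\ (d < n)%N]%classic.

(** * Equitable stochastic block model *)

Section EquitableSBM.
Variables (R : realType) (d k : nat) (eta : R).

Definition sbm_mx : 'M[R]_k := eta%:M + ((1 - eta) / k%:R) *: const_mx 1.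

Definition sbm_defined : set nat :=
  [set n | [/\ (k %| n)%N,
               forall i j, d%:R * sbm_mx i j \is a Num.nat &
               forall i, exists m : nat,
                 d%:R * sbm_mx i i * (n %/ k)%N%:R = (2 * m)%N%:R]]%classic.

Definition balanced (n : nat) : {set {ffun 'I_n -> 'I_k}} :=
  [set s : {ffun 'I_n -> 'I_k} | [forall i, #|[set v | s v == i]| == (n %/ k)%N]].

(* On a set e of two vertices, s @: e = {i, j} says that e joins the classes i
   and j; when i = j it says that e lies inside the class i. *)
Definition block (n : nat) (s : {ffun 'I_n -> 'I_k}) (i j : 'I_k)
    (E : {set {set 'I_n}}) : {set {set 'I_n}} :=
  [set e in E | [set s x | x in e] == [set i; j]].

(* For i = j: the d M_ii-regular graphs on the class i. For i != j: the
   bipartite graphs between the classes i and j with all degrees d M_ij. *)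
Definition block_graphs (n : nat) (s : {ffun 'I_n -> 'I_k}) (i j : 'I_k) :
    {set {set {set 'I_n}}} :=
  [set E : {set {set 'I_n}} | [&& simple_edges E, block s i j E == E &
    [forall v, (s v \in [set i; j]) ==>
      (#|nbrs E v|%:R == d%:R * sbm_mx i j)]]].

(* Given s, the edge sets placed on the pairs of classes are independent and
   uniform, hence the product over i <= j. *)
Definition eSBM (n : nat) (G : sgraph n) : R :=
  \sum_(s : {ffun 'I_n -> 'I_k}) unif R (balanced n) s *
    \prod_(i < k) \prod_(j < k | (i <= j)%N)
      unif R (block_graphs s i j) (block s i j (edges G)).

End EquitableSBM.

(** * The noise operator *)

(* ((i, j), (k, l)) *)
Definition quad (n : nat) := (('I_n * 'I_n) * ('I_n * 'I_n))%type.

Definition swaps (n : nat) (G : sgraph n) : {set quad n} :=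
  [set q : quad n | let: ((i, j), (k, l)) := q in
    [&& [set i; j] \in edges G, [set k; l] \in edges G,
        [set i; j] != [set k; l], i != k, j != l,
        [set i; k] \notin edges G & [set j; l] \notin edges G]].

(* The default value G of insubd is irrelevant when q \in swaps G: the new edge
   set is then simple. *)
Definition swap (n : nat) (G : sgraph n) (q : quad n) : sgraph n :=
  let: ((i, j), (k, l)) := q in
  insubd G ((edges G :\: [set [set i; j]; [set k; l]])
            :|: [set [set i; k]; [set j; l]]).

(* A graph without admissible swap is left unchanged. *)
Definition swap_kernel (R : realType) (n : nat) (G H : sgraph n) : R :=
  if swaps G == finset.set0 then (H == G)%:R
  else Pr (unif R (swaps G)) [pred q | swap G q == H].

Definition swap_law (R : realType) (n : nat) (p : sgraph n -> R)
    (H : sgraph n) : R :=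
  \sum_(G : sgraph n) p G * swap_kernel R G H.

Definition noise (R : realType) (delta : R) (n : nat) (p : sgraph n -> R) :
    sgraph n -> R :=
  iter (Num.truncn (delta * n%:R)) (@swap_law R n) p.

Definition noisy_eSBM (R : realType) (d k : nat) (eta delta : R) (n : nat) :
    sgraph n -> R :=
  noise delta (@eSBM R d k eta n).

(** * Distinguishing *)

Definition verdict := bool.
Definition verdict_p : verdict := true.
Definition verdict_q : verdict := false.

Definition polytime_test (t : forall n, sgraph n -> verdict) : Prop :=
  polytime enc_graph (fun b : verdict => [:: b]) t.

(* The limit is taken along the n in D, where both laws are defined. *)
Definition distinguishes (R : realType) (D : set nat)
    (P Q : forall n, sgraph n -> R) (t : forall n, sgraph n -> verdict) : Prop :=
  ((fun n => Pr (P n) [pred G | t n G == verdict_q]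
           + Pr (Q n) [pred G | t n G == verdict_p]) @ within D \oo
     --> (0 : R))%classic.

(* The formula is read as +oo at eta = 0. *)
Definition dKS (R : realType) (eta : R) : \bar R :=
  if eta == 0 then +oo%E
  else (2 / eta ^+ 2 * (1 + Num.sqrt (1 - eta ^+ 2)))%:E.

Definition eSBM_hypothesis (R : realType) : Prop :=
  forall (delta : R) (k d : nat) (eta : R),
    0 < delta -> (2 <= k)%N ->
    - (k%:R - 1)^-1 <= eta -> eta <= 1 ->
    (d%:R%:E < dKS eta)%E ->
    (1 - eta) * d%:R / k%:R \is a Num.int ->
    ~ exists t : forall n, sgraph n -> verdict,
        polytime_test t /\
        distinguishes (sbm_defined d k eta `&` Gnd_defined d)%classic
          (@noisy_eSBM R d k eta delta) (@Gnd R d) t.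

(** * Certification *)

Definition partition_mx (R : realType) (n k : nat) (s : {ffun 'I_n -> 'I_k}) :
    'M[R]_n :=
  \matrix_(i, j) (if s i == s j then 1 else - (k%:R - 1)^-1).

Definition mx_inner (R : realType) (n : nat) (X Y : 'M[R]_n) : R :=
  \sum_i \sum_j X i j * Y i j.

(* A supremum over the finitely many s, hence a maximum. *)
Definition Gamma (R : realType) (k n : nat) (X : 'M[R]_n) : R :=
  sup [set mx_inner (partition_mx R s) (- X) | s in [set: {ffun 'I_n -> 'I_k}]]%classic.

Definition MC (R : realType) (k n : nat) (G : sgraph n) : R :=
  (\max_(s : {ffun 'I_n -> 'I_k}) #|cut_edges s G|)%N%:R / #|edges G|%:R.

(* Real inputs cannot be given to a Turing machine: the function is required to
   be computable in polynomial time, with rational values, on rational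
   matrices, where the size of an input is its bit length. *)
Definition polytime_mx (R : realType) (A : forall n, 'M[R]_n -> R) : Prop :=
  exists2 f : forall n, 'M[rat]_n -> rat,
    forall n (X : 'M[rat]_n), A n (map_mx ratr X) = ratr (f n X) &
    polytime enc_mx enc_rat f.

Definition polytime_graph (R : realType) (A : forall n, sgraph n -> R) : Prop :=
  exists2 f : forall n, sgraph n -> rat,
    forall n (G : sgraph n), A n G = ratr (f n G) &
    polytime enc_graph enc_rat f.

Definition certifies_Gamma (R : realType) (k : nat) (D : set nat)
    (Q : forall n, sgraph n -> R) (B : nat -> R)
    (A : forall n, 'M[R]_n -> R) : Prop :=
  (forall n (X : 'M[R]_n), Gamma k X <= A n X) /\
  ((fun n => Pr (Q n) [pred G | A n (adjmx R G) <= B n]) @ within D \oo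
     --> (1 : R))%classic.

(* MC is only meaningful for graphs with at least one edge. *)
Definition certifies_MC (R : realType) (k : nat) (D : set nat)
    (Q : forall n, sgraph n -> R) (B : nat -> R)
    (A : forall n, sgraph n -> R) : Prop :=
  (forall n (G : sgraph n), (0 < #|edges G|)%N -> MC R k G <= A n G) /\
  ((fun n => Pr (Q n) [pred G | A n G <= B n]) @ within D \oo
     --> (1 : R))%classic.

(* Main.v *)
(** A certificate for [Gamma_k] or [MC_k] yields a polynomial-time test that
    contradicts the hypothesis. In a graph drawn from the equitable SBM the
    planted classes cut exactly [n d (k-1)(1-eta)/(2k)] of the [n d/2] edges, and
    one swap of the noise operator destroys at most two cut edges. With [delta]
    small compared to [eps], every graph in the support of the noisy SBM thus has
    a certificate value above a rational threshold, whereas the certified bound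
    lies below that threshold with high probability on [G_{n,d}]. The test
    compares the output of the certification algorithm with the threshold.

    That the test is polynomial-time is shown on an explicit Turing machine: it
    saves [n] in unary, runs the given machine, reads the numerator [a] and the
    denominator [b] of its output, and decides [(p0 + n p1) b <= q a] by computing
    [q a - p0 b] and then subtracting [p1 b] [n] times. Each of these passes
    scans the two operands with a bounded carry, so [n b] is never multiplied
    out. *)

Require Import Defs.
From HB Require Import structures.
From mathcomp Require Import all_boot all_order all_algebra.
From mathcomp Require Import all_classical all_reals all_analysis.
From mathcomp Require Import zify ring lra.
Import Order.TTheory GRing.Theory Num.Theory.
Import numFieldNormedType.Exports.
Local Open Scope ring_scope.

Set Implicit Arguments.
Unset Strict Implicit.
Unset Printing Implicit Defensive.

Local Open Scope nat_scope.

(** * Turing machines with absolute head positions *)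

(* The contents of the cells, indexed by their absolute position, and the
   position of the head: contrary to Defs.tape, moving back and forth or
   rewriting the symbol under the head restores the very same value. *)
Definition atape : Type := (int -> symbol) * int.

Definition aread (t : atape) : symbol := t.1 t.2.

Definition awrite (a : symbol) (t : atape) : atape :=
  (fun i => if i == t.2 then a else t.1 i, t.2).

Definition displacement (m : move) : int :=
  match m with MoveL => -1 | MoveR => 1 | Stay => 0 end%R.

Definition amove (m : move) (t : atape) : atape := (t.1, (t.2 + displacement m)%R).

Definition act (a : symbol * move) (t : atape) : atape :=
  amove a.2 (awrite a.1 t).

Definition aconfig (M : tm) : Type :=
  tm_state M * ('I_(tm_aux M).+1 -> atape).

Definition astep (M : tm) (c : aconfig M) : aconfig M :=
  if tm_halt c.1 then c else
  let r := tm_trans c.1 [ffun i => aread (c.2 i)] in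
  (r.1, fun i => act (r.2 i) (c.2 i)).

Definition written (s : seq bool) : int -> symbol :=
  fun i => if i is Posz j then nth None (map Some s) j else None.

Lemma written_neg s (z : int) : (z < 0)%R -> written s z = None.
Proof. by case: z. Qed.

Definition ainit (M : tm) (w : seq bool) : aconfig M :=
  (tm_start M, fun i => (written (if i == ord0 then w else [::]), 0%R)).

Definition represents (t : tape) (a : atape) : Prop :=
  (forall i : nat, nth None t.1 i = a.1 (a.2 - 1 - i%:Z)%R) /\
  (forall i : nat, nth None t.2 i = a.1 (a.2 + i%:Z)%R).

Lemma represents_read t a : represents t a -> tape_read t = aread a.
Proof. by case=> _ /(_ 0); rewrite nth0 addr0. Qed.

Lemma represents_act t a b m : represents t a ->
  represents (tape_move m (tape_write b t)) (act (b, m) a).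
Proof.
case: t a => [l r] [f p] [/= Hl Hr].
have Hw (i : nat) z : z = (p + i%:Z)%R ->
    nth None (b :: behead r) i = (awrite b (f, p)).1 z.
  move=> ->; case: i => [|i] /=; first by rewrite addr0 eqxx.
  rewrite nth_behead Hr ifF //; apply/eqP; lia.
have Hl' (i : nat) z : z = (p - 1 - i%:Z)%R ->
    nth None l i = (awrite b (f, p)).1 z.
  move=> -> /=; rewrite Hl ifF //; apply/eqP; lia.
rewrite /act /amove; case: m; split=> i; rewrite [_.2]/= [_.1]/=.
- by rewrite nth_behead; apply: Hl'; rewrite /=; lia.
- case: i => [|i]; first by rewrite /= -nth0; apply: Hl'; rewrite /=; lia.
  by apply: (Hw i); rewrite /=; lia.
- case: i => [|i]; first by apply: (Hw 0); rewrite /=; lia.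
  by apply: Hl'; rewrite /=; lia.
- by apply: (Hw i.+1); rewrite /=; lia.
- by apply: Hl'; rewrite /=; lia.
- by apply: (Hw i); rewrite /=; lia.
Qed.

Definition crepresents (M : tm) (c : tm_config M) (a : aconfig M) : Prop :=
  c.1 = a.1 /\ forall i, represents (c.2 i) (a.2 i).

Lemma crepresents_step M (c : tm_config M) (a : aconfig M) :
  crepresents c a -> crepresents (tm_step c) (astep a).
Proof.
case: c a => [q t] [q' t'] [/= <- H]; rewrite /tm_step /astep /=.
case: ifP => // _.
have -> : [ffun i => tape_read (t i)] = [ffun i => aread (t' i)].
  by apply/ffunP => i; rewrite !ffunE; apply: represents_read.
split=> //= i; rewrite ffunE.
by case: (_ i) => b m /=; apply: represents_act.
Qed.

Lemma crepresents_iter M (c : tm_config M) (a : aconfig M) n :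
  crepresents c a -> crepresents (iter n (@tm_step M) c) (iter n (@astep M) a).
Proof. by move=> H; elim: n => //= n IH; apply: crepresents_step. Qed.

Lemma crepresents_init M w : crepresents (tm_init M w) (ainit M w).
Proof.
split=> //= i; rewrite ffunE; case: eqP => _; split=> j /=.
- by rewrite nth_nil written_neg //; lia.
- by rewrite ?add0r.
- by rewrite nth_nil written_neg //; lia.
- by rewrite ?add0r.
Qed.

(** The bound [j <= size o] includes the cell just after [o], which has to be blank for the output
    to stop there. *)
Lemma leading_bitsP s o :
  (forall j, j <= size o -> nth None s j = nth None (map Some o) j) <->
  leading_bits s = o.
Proof.
split.
  elim: o s => [|b o IH] [|[c|] s] H //=.
  - by have := H 0 isT.
  - by have := H 0 isT.
  - have [->] : Some c = Some b by have := H 0 isT.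
    by rewrite (IH s) // => j hj; have := H j.+1 hj.
  - by have := H 0 isT.
move=> <- {o}; elim: s => [|[b|] s IH] j //=; rewrite ?leqn0.
- by case: j => // j; rewrite ltnS => /IH.
- by move=> /eqP ->.
Qed.

Lemma size_leading_bits s : size (leading_bits s) <= size s.
Proof. by elim: s => [|[b|] s IH]. Qed.

(** One step lists at most two new cells: one by writing on an empty list, one by moving left past
    the listed cells. This bounds the length of the output of [M], hence the cost of parsing it. *)
Lemma size_tape_iter M (c : tm_config M) n i :
  size ((iter n (@tm_step M) c).2 i).1 + size ((iter n (@tm_step M) c).2 i).2
  <= size (c.2 i).1 + size (c.2 i).2 + n.*2.
Proof.
elim: n => [|n IH]; first by rewrite addn0.
rewrite iterS; set c' := iter n _ c in IH *.
rewrite doubleS; apply: (@leq_trans (size (c'.2 i).1 + size (c'.2 i).2).+2); last lia.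
rewrite /tm_step; case: ifP => _; first lia.
rewrite /= ffunE; move: (_ i) (c'.2 i) => [b m] [l r].
by case: m; rewrite /tape_write /tape_move /= ?size_behead; lia.
Qed.

Lemma size_tm_output M w n :
  size (tm_output (iter n (@tm_step M) (tm_init M w))) <= size w + n.*2.
Proof.
apply: leq_trans (size_leading_bits _) _.
have := size_tape_iter (tm_init M w) n ord_max.
have : size ((tm_init M w).2 ord_max).1 + size ((tm_init M w).2 ord_max).2
    <= size w.
  by rewrite /= ffunE; case: eqP => _ /=; rewrite ?size_map.
lia.
Qed.

Lemma iter_halted M (c : aconfig M) n : tm_halt c.1 -> iter n (@astep M) c = c.
Proof. by move=> h; elim: n => //= n ->; rewrite /astep h. Qed.

Lemma computes_within_astep M w T o :
  tm_computes_within M w T o <->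
  let c := iter T (@astep M) (ainit M w) in
  tm_halt c.1 /\ forall j, j <= size o ->
    (c.2 ord_max).1 ((c.2 ord_max).2 + j%:Z)%R = nth None (map Some o) j.
Proof.
rewrite /tm_computes_within /tm_output /=.
have [-> Ht] := crepresents_iter T (crepresents_init M w).
have [_ {}Ht] := Ht ord_max.
split=> -[h H]; split=> //; first by move=> j hj; rewrite -Ht; move/leading_bitsP: H; apply.
by apply/leading_bitsP => j hj; rewrite Ht; apply: H.
Qed.

Lemma act_keep m t : act (aread t, m) t = amove m t.
Proof.
by case: t => f p; congr (_, _); apply/funext => i /=; case: eqP => // ->.
Qed.

Lemma amove_stay t : amove Stay t = t.
Proof. by case: t => f p; rewrite /amove addr0. Qed.

Lemma written_rcons s b p : p = (size s)%:Z ->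
  awrite (Some b) (written s, p) = (written (rcons s b), p).
Proof.
move=> ->; congr (_, _); apply/funext => -[i|i] //=.
rewrite map_rcons nth_rcons size_map eqz_nat.
by case: ltngtP => // h; rewrite nth_default ?size_map // ltnW.
Qed.

Lemma written_update s a s' b p : p = (size s)%:Z ->
  awrite (Some b) (written (s ++ a :: s'), p) = (written (s ++ b :: s'), p).
Proof.
move=> ->; congr (_, _); apply/funext => -[i|i] //=.
rewrite !map_cat !nth_cat !size_map eqz_nat /=.
case: ltngtP => // [h|->]; last by rewrite subnn.
by have [j ->] : exists j, i - size s = j.+1 by exists (i - size s).-1; lia.
Qed.

(** * Binary numerals, least significant bit first *)

Fixpoint bits_val (s : seq bool) : nat :=
  if s is b :: s' then b + 2 * bits_val s' else 0.

Lemma bits_val_rcons s b : bits_val (rcons s b) = bits_val s + 2 ^ size s * b.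
Proof. by elim: s => [|c s IH] /=; [lia | rewrite IH expnS; lia]. Qed.

Lemma bits_val_lt s : bits_val s < 2 ^ size s.
Proof. by elim: s => [|[] s IH] //=; rewrite expnS; lia. Qed.

Lemma bits_val_drop s j :
  bits_val (drop j s) = nth false s j + 2 * bits_val (drop j.+1 s).
Proof.
by elim: s j => [|b s IH] [|j] //=; rewrite ?drop0 ?IH.
Qed.

Lemma nat_bitsK m : bits_val (nat_bits m) = m.
Proof.
(* Any number [l] of digits represents the residue modulo [2 ^ l]; halving [a] shifts the digits by
   one. *)
have H l : forall a, bits_val (mkseq (fun i => odd (a %/ 2 ^ i)) l) = a %% 2 ^ l.
  elim: l => [|l IH] a; first by rewrite modn1.
  rewrite /mkseq /= -[1]/(1 + 0) iotaDl -map_comp /=.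
  rewrite (eq_map (g := fun i => odd (a./2 %/ 2 ^ i))); last first.
    by move=> i /=; rewrite -divn2 -divnMA -expnS.
  rewrite IH divn1 -divn2 modn_divl expnSr mulnC addnC.
  by rewrite [RHS](divn_eq _ 2) (modn_dvdm _ (dvdn_mull _ (dvdnn 2))) modn2.
by rewrite H modn_small // up_logP.
Qed.

(** * A machine comparing the output of a machine with a threshold *)

(** [Copy] and [Back] duplicate the unary [n] and return to the start. After the run of [M], [Sign]
    to [DenRew] decode numerator and denominator onto two tapes. [PassFirst] computes [q a - p0 b],
    each [PassNext] subtracts [p1 b], and [Round] consumes one mark of [n] per subtraction. *)
Variant phase := Copy | Back | Sign | NumTag | NumBit | NumRew | DenTag | DenBit
  | DenRew | PassFirst | PassNext | PassRew | Round | Halt.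

Definition phases := [:: Copy; Back; Sign; NumTag; NumBit; NumRew; DenTag;
  DenBit; DenRew; PassFirst; PassNext; PassRew; Round; Halt].

Definition phase_code (x : phase) : 'I_14 := inord
  match x with Copy => 0 | Back => 1 | Sign => 2 | NumTag => 3 | NumBit => 4
  | NumRew => 5 | DenTag => 6 | DenBit => 7 | DenRew => 8 | PassFirst => 9
  | PassNext => 10 | PassRew => 11 | Round => 12 | Halt => 13 end.

Lemma phase_codeK : cancel phase_code (fun i => nth Halt phases i).
Proof. by case; rewrite /phase_code inordK. Qed.

HB.instance Definition _ := Finite.copy phase (can_type phase_codeK).

Section Threshold.
Variables (M : tm) (g : bool -> bool -> bool) (q p0 p1 : nat).
Hypothesis q_gt0 : 0 < q.

Let m := tm_aux M.
(** The carry of a pass stays between [- K] and [K], because [K] dominates every multiplier. *)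
Let K := q + p0 + p1.

Definition ctl : Type := (phase * bool * 'I_(K + K).+1)%type.

Definition nstate : Type := (tm_state M + ctl)%type.

Definition blank (a : symbol) : bool := ~~ isSome a.
Arguments blank : simpl never.

Definition action : Type := (symbol * move)%type.

(* rd is read on the tapes of M, u on the unary copy of n, y and d on the two
   operands, o on the output tape. The sign of the output of M is sg, and e - K
   is the carry of the current pass. *)
Definition strans (s : nstate) (rd : 'I_m.+1 -> symbol) (u y d o : symbol) :
    nstate * ('I_m.+1 -> action) * action * action * action * action :=
  let go ph sg e x mv au ay ad :=
    (inr (ph, sg, e) : nstate,
     fun i => (rd i, if i == x then mv else Stay), au, ay, ad, (o, Stay)) in
  let stop sg e c :=
    (inr (Halt, sg, e) : nstate,
     fun i => (rd i, Stay),
     (u, Stay), (y, Stay), (d, Stay), (Some (g sg c), Stay)) in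
  let rewind ph ph' sg e :=
    let mv := if blank y && blank d then MoveR else MoveL in
    go (if blank y && blank d then ph' else ph) sg e ord0 Stay
      (u, Stay) (y, mv) (d, mv) in
  let pass (first : bool) sg (e : 'I_(K + K).+1) :=
    let ph := if first then PassFirst else PassNext in
    if [&& blank y, blank d & e < K] then stop sg e false
    else if [&& blank y, blank d & (e : nat) == K] then
      go PassRew sg e ord0 Stay (u, Stay) (y, MoveL) (d, MoveL)
    else
      let r := e + (if first then q else 1) * (y == Some true)
               + (K - (if first then p0 else p1) * (d == Some true)) in
      go ph sg (inord r./2) ord0 Stay (u, Stay) (Some (odd r), MoveR) (d, MoveR)
  in
  match s with
  | inl s => if tm_halt s then
      go Sign false ord0 ord0 Stay (u, Stay) (y, Stay) (d, Stay)
    else let r := tm_trans s [ffun i => rd i] in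
      (inl r.1, fun i => r.2 i, (u, Stay), (y, Stay), (d, Stay), (o, Stay))
  | inr (ph, sg, e) =>
    match ph with
    | Copy => if rd ord0 == Some true then
        go Copy sg e ord0 MoveR (Some true, MoveR) (y, Stay) (d, Stay)
      else go Back sg e ord0 MoveL (u, MoveL) (y, Stay) (d, Stay)
    | Back => if blank u then
        (inl (tm_start M), fun i => (rd i, if i == ord0 then MoveR else Stay),
         (u, MoveR), (y, Stay), (d, Stay), (o, Stay))
      else go Back sg e ord0 MoveL (u, MoveL) (y, Stay) (d, Stay)
    | Sign => go NumTag (rd ord_max == Some true) e ord_max MoveR
        (u, Stay) (y, Stay) (d, Stay)
    | NumTag => if rd ord_max == Some true then
        go NumBit sg e ord_max MoveR (u, Stay) (y, Stay) (d, Stay)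
      else go NumRew sg e ord_max MoveR (u, Stay) (y, MoveL) (d, MoveL)
    | NumBit => go NumTag sg e ord_max MoveR
        (u, Stay) (rd ord_max, MoveR) (d, MoveR)
    | NumRew => rewind NumRew DenTag sg e
    | DenTag => if rd ord_max == Some true then
        go DenBit sg e ord_max MoveR (u, Stay) (y, Stay) (d, Stay)
      else go DenRew sg e ord_max MoveR (u, Stay) (y, MoveL) (d, MoveL)
    | DenBit => go DenTag sg e ord_max MoveR
        (u, Stay) (y, MoveR) (rd ord_max, MoveR)
    | DenRew => rewind DenRew PassFirst sg (inord K)
    | PassFirst => pass true sg e
    | PassNext => pass false sg e
    | PassRew => rewind PassRew Round sg e
    | Round => if blank u then stop sg e true
      else go PassNext sg (inord K) ord0 Stay (u, MoveR) (y, Stay) (d, Stay)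
    | Halt => stop sg e true
    end
  end.

Definition halted (s : nstate) : bool :=
  if s is inr (Halt, _, _) then true else false.

(** The tapes of [M] come first, so that the input tape is shared. The output tape is the last of
    the four extra ones and is reached as the default value of [nth]. *)
Definition threshold_tm : tm :=
  @TM (m + 4) nstate (inr (Copy, false, ord0)) halted
    (fun s rd =>
       let rd' : 'I_(m.+1 + 4) -> symbol := rd in
       let ex k := rd' (rshift m.+1 k) in
       let: (s', am, au, ay, ad, ao) :=
         strans s (fun i => rd' (lshift 4 i))
           (ex (inord 0)) (ex (inord 1)) (ex (inord 2)) (ex (inord 3)) in
       (s', [ffun i => match @fintype.split m.+1 4 i with
                       | inl j => am j
                       | inr j => nth ao [:: au; ay; ad] j
                       end])).

(** Tapes named by their role keep index computations out of the runs; [flat] gives back the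
    configuration of [threshold_tm]. *)
Record sconfig := SConfig {
  s_state : nstate; s_tapes : 'I_m.+1 -> atape;
  s_u : atape; s_y : atape; s_d : atape; s_o : atape }.

Definition sstep (c : sconfig) : sconfig :=
  if halted (s_state c) then c else
  let: (s', am, au, ay, ad, ao) :=
    strans (s_state c) (fun i => aread (s_tapes c i))
      (aread (s_u c)) (aread (s_y c)) (aread (s_d c)) (aread (s_o c)) in
  SConfig s' (fun i => act (am i) (s_tapes c i))
    (act au (s_u c)) (act ay (s_y c)) (act ad (s_d c)) (act ao (s_o c)).

Definition flat (c : sconfig) : aconfig threshold_tm :=
  (s_state c,
   fun i => match @fintype.split m.+1 4 i with
            | inl j => s_tapes c j
            | inr j => nth (s_o c) [:: s_u c; s_y c; s_d c] j
            end).

Lemma astep_flat c : astep (flat c) = flat (sstep c).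
Proof.
rewrite /astep /sstep; case: c => s t u y d o /=; case: ifP => // _.
have -> : (fun i => [ffun i => aread ((flat (SConfig s t u y d o)).2 i)]
             (lshift 4 i : 'I_(m.+1 + 4))) = fun i => aread (t i).
  by apply/funext => i; rewrite ffunE /= -/(unsplit (inl i)) unsplitK.
rewrite !ffunE /= -!/(unsplit (inr _)) !unsplitK !inordK //=.
case: (strans _ _ _ _ _ _) => [[[[[s' am] au] ay] ad] ao].
congr (_, _); apply/funext => i; rewrite ffunE.
by case: (fintype.split _) => [j|[[|[|[|j]]] hj]] //=; rewrite !nth_nil.
Qed.

(** * Time-bounded runs, phase by phase *)

Definition runs (T : nat) (c c' : sconfig) : Prop :=
  exists2 T', T' <= T & iter T' sstep c = c'.

Lemma runs_refl c : runs 0 c c.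
Proof. by exists 0. Qed.

Lemma runs_step T c c' : runs T (sstep c) c' -> runs T.+1 c c'.
Proof. by case=> T' h <-; exists T'.+1; rewrite ?iterSr. Qed.

Lemma runs_trans T1 T2 a b c : runs T1 a b -> runs T2 b c -> runs (T1 + T2) a c.
Proof.
by case=> i hi <- [j hj <-]; exists (j + i); rewrite ?iterD //; lia.
Qed.

Lemma runs_leq T T' c c' : T <= T' -> runs T c c' -> runs T' c c'.
Proof. by move=> h [i hi <-]; exists i => //; apply: leq_trans h. Qed.

Definition at_pos x z (t : 'I_m.+1 -> atape) : 'I_m.+1 -> atape :=
  fun i => if i == x then ((t i).1, z) else t i.

Arguments at_pos : simpl never.
Arguments aread : simpl never.
Arguments written : simpl never.
Arguments act : simpl never.

Lemma at_posE x z t : at_pos x z t x = ((t x).1, z).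
Proof. by rewrite /at_pos eqxx. Qed.

Lemma act_at_pos x z t mv :
  (fun i => act (aread (at_pos x z t i), if i == x then mv else Stay)
              (at_pos x z t i)) = at_pos x (z + displacement mv)%R t.
Proof.
apply/funext => i; rewrite act_keep /at_pos; case: eqP => // _.
by rewrite amove_stay.
Qed.

Lemma act_stay x (t : 'I_m.+1 -> atape) :
  (fun i => act (aread (t i), if i == x then Stay else Stay) (t i)) = t.
Proof. by apply/funext => i; rewrite act_keep if_same amove_stay. Qed.

Lemma act_keep_stay t : act (aread t, Stay) t = t.
Proof. by rewrite act_keep amove_stay. Qed.

Definition stepE := (act_at_pos, act_stay, act_keep_stay, act_keep).

Lemma aread_written s (i : nat) : aread (written s, i%:Z) = nth None (map Some s) i.
Proof. by []. Qed.

Lemma blank_written_neg s (z : int) :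
  (z < 0)%R -> blank (aread (written s, z)).
Proof. by move=> h; rewrite /blank /aread /= written_neg. Qed.

Lemma blank_written s i :
  blank (aread (written s, Posz i)) = (size s <= i).
Proof.
rewrite /blank aread_written; case: leqP => h; first by rewrite nth_default ?size_map.
by rewrite (nth_map false).
Qed.

Lemma aread_written_true s i :
  (aread (written s, Posz i) == Some true) = nth false s i.
Proof.
rewrite aread_written; case: (leqP (size s) i) => h.
  by rewrite !nth_default ?size_map.
by rewrite (nth_map false) //; case: nth.
Qed.

(** The last step reads the separator [false] and already moves both heads one cell to the left,
    hence [n - 1]. *)
Lemma runs_copy n w sg e t y d o :
  (t ord0).1 = written (nseq n true ++ false :: w) ->
  forall j i, i + j = n ->
  runs j.+1
    (SConfig (inr (Copy, sg, e)) (at_pos ord0 i%:Z t)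
       (written (nseq i true), i%:Z) y d o)
    (SConfig (inr (Back, sg, e)) (at_pos ord0 (n%:Z - 1) t)
       (written (nseq n true), (n%:Z - 1)%R) y d o).
Proof.
move=> Ht; elim=> [|j IH] i hi; apply: runs_step.
  have {hi} -> : i = n by lia.
  rewrite /sstep /= at_posE Ht aread_written_true nth_cat size_nseq ltnn subnn.
  by rewrite /= !stepE; apply: runs_refl.
rewrite /sstep /= at_posE Ht aread_written_true nth_cat size_nseq.
rewrite (_ : i < n) ?nth_nseq; last lia.
rewrite (_ : i < n) /= ?stepE; last lia.
rewrite /act /= written_rcons ?size_nseq // /amove /=.
have -> : rcons (nseq i true) true = nseq i.+1 true.
  by elim: (i) => //= k ->.
by rewrite (_ : i%:Z + 1 = i.+1%:Z)%R; [apply: IH; lia | lia].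
Qed.

(** Both heads move together, so the blank cell [-1] of the unary copy also marks the left end of
    the input tape. [M] then starts from its genuine initial configuration. *)
Lemma runs_back n sg e t y d o j :
  j <= n ->
  runs j.+1
    (SConfig (inr (Back, sg, e)) (at_pos ord0 (j%:Z - 1) t)
       (written (nseq n true), (j%:Z - 1)%R) y d o)
    (SConfig (inl (tm_start M)) (at_pos ord0 0%R t)
       (written (nseq n true), 0%R) y d o).
Proof.
elim: j => [|j IH] hj; apply: runs_step.
  rewrite /sstep /= ?blank_written_neg //= !stepE; exact: runs_refl.
rewrite (_ : j.+1%:Z - 1 = j%:Z)%R; last lia.
rewrite /sstep /= blank_written size_nseq leqNgt hj /= !stepE.
by apply: IH; apply: ltnW.
Qed.

Lemma runs_simulation u y d o T (c : aconfig M) :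
  tm_halt (iter T (@astep M) c).1 ->
  runs T.+1 (SConfig (inl c.1) c.2 u y d o)
    (SConfig (inr (Sign, false, ord0)) (iter T (@astep M) c).2 u y d o).
Proof.
elim: T c => [|T IH] [s t] /=.
  by move=> h; apply: runs_step; rewrite /sstep /= h !stepE; apply: runs_refl.
case: (boolP (tm_halt s)) => hs.
  have -> : astep (iter T (@astep M) (s, t)) = (s, t).
    by rewrite -iterS iter_halted.
  move=> _; apply: runs_step; rewrite /sstep /= hs !stepE.
  exact: (runs_leq (leq0n _) (runs_refl _)).
rewrite -iterS iterSr => /IH H; apply: runs_step.
move: H; rewrite /sstep /= /astep /= (negbTE hs) /= !stepE.
by [].
Qed.

Definition rewinding (ph ph' : phase) : Prop :=
  (ph, ph') = (NumRew, DenTag) \/ (ph, ph') = (DenRew, PassFirst) \/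
  (ph, ph') = (PassRew, Round).

(** Below [maxn (size ys) (size ds)] at least one operand is nonblank, so the heads turn only at
    cell [-1]. [DenRew] resets the carry to zero, stored as [K]. *)
Lemma runs_rewind ph ph' sg e t u ys ds o j :
  rewinding ph ph' ->
  j <= maxn (size ys) (size ds) ->
  exists e', runs j.+1
    (SConfig (inr (ph, sg, e)) t u
       (written ys, (j%:Z - 1)%R) (written ds, (j%:Z - 1)%R) o)
    (SConfig (inr (ph', sg, if ph is DenRew then inord K else e')) t u
       (written ys, 0%R) (written ds, 0%R) o).
Proof.
move=> Hph hj; exists e.
elim: j e hj => [|j IH] e hj.
  apply: runs_step.
  case: Hph => [[-> ->]|[[-> ->]|[-> ->]]];
  rewrite /sstep /= ?blank_written_neg //= !stepE; exact: runs_refl.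
rewrite (_ : j.+1%:Z - 1 = j%:Z)%R; last lia.
have hn : blank (aread (written ys, j%:Z)) && blank (aread (written ds, j%:Z))
   = false by rewrite !blank_written; lia.
have := IH _ (ltnW hj).
by case: Hph => [[-> ->]|[[-> ->]|[-> ->]]] => H; apply: runs_step;
  rewrite /sstep /= hn !stepE; apply: H.
Qed.

Lemma act_rcons s b z : z = (size s)%:Z ->
  act (Some b, MoveR) (written s, z) = (written (rcons s b), (size s).+1%:Z).
Proof.
by move=> ->; rewrite /act written_rcons // /amove /=; congr (_, _); lia.
Qed.

Lemma act_update s a s' b z : z = (size s)%:Z ->
  act (Some b, MoveR) (written (s ++ a :: s'), z) =
  (written (s ++ b :: s'), (size s).+1%:Z).
Proof.
by move=> ->; rewrite /act written_update // /amove /=; congr (_, _); lia.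
Qed.

Definition reads (f : int -> symbol) (z : int) (s : seq bool) : Prop :=
  forall j, j < size s -> f (z + j%:Z)%R = Some (nth false s j).

Lemma reads_cons f z a s :
  reads f z (a :: s) -> f z = Some a /\ reads f (z + 1)%R s.
Proof.
move=> H; split; first by have := H 0 isT; rewrite addr0.
by move=> j hj; rewrite -(H j.+1 hj); congr f; lia.
Qed.

Lemma aread_pair f z : aread (f, z) = f z.
Proof. by []. Qed.

(** [enc_nat a] is convertible to [tagged (nat_bits a)]. *)
Definition tagged (l : seq bool) : seq bool :=
  flatten [seq [:: true; b] | b <- l] ++ [:: false].

(** [zs] holds the bits decoded so far. The head of the other operand tape moves along, so that one
    position describes both tapes. *)
Lemma runs_num l zs f z sg e t u o :
  (t ord_max).1 = f -> reads f z (tagged l) ->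
  runs (2 * size l).+1
    (SConfig (inr (NumTag, sg, e)) (at_pos ord_max z t) u
       (written zs, (size zs)%:Z) (written [::], (size zs)%:Z) o)
    (SConfig (inr (NumRew, sg, e))
       (at_pos ord_max (z + (size (tagged l))%:Z) t) u
       (written (zs ++ l), (size (zs ++ l))%:Z - 1)%R
       (written [::], (size (zs ++ l))%:Z - 1)%R o).
Proof.
move=> Ht; elim: l zs z => [|b l IH] zs z /reads_cons [h1 h].
  apply: runs_step; rewrite /sstep /= at_posE Ht (aread_pair f) h1 /= !stepE cats0.
  exact: runs_refl.
have [h2 {}h] := reads_cons h.
rewrite /= (_ : (2 * (size l).+1).+1 = (2 * size l).+1.+2); last lia.
apply: runs_step; rewrite /sstep /= at_posE Ht (aread_pair f) h1 /= !stepE.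
apply: runs_step; rewrite /sstep /= at_posE Ht (aread_pair f) h2 /= !stepE.
have := IH (rcons zs b) _ h; rewrite act_rcons // size_rcons cat_rcons.
have -> : amove MoveR (written [::], (size zs)%:Z) =
          (written [::], (size zs).+1%:Z).
  by rewrite /amove /=; congr (_, _); lia.
by rewrite (_ : z + (size (tagged l)).+2%:Z =
                z + 1 + 1 + (size (tagged l))%:Z)%R //; lia.
Qed.

Lemma runs_den l zs ys f z sg e t u o :
  (t ord_max).1 = f -> reads f z (tagged l) ->
  runs (2 * size l).+1
    (SConfig (inr (DenTag, sg, e)) (at_pos ord_max z t) u
       (written ys, (size zs)%:Z) (written zs, (size zs)%:Z) o)
    (SConfig (inr (DenRew, sg, e))
       (at_pos ord_max (z + (size (tagged l))%:Z) t) u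
       (written ys, (size (zs ++ l))%:Z - 1)%R
       (written (zs ++ l), (size (zs ++ l))%:Z - 1)%R o).
Proof.
move=> Ht; elim: l zs z => [|b l IH] zs z /reads_cons [h1 h].
  apply: runs_step; rewrite /sstep /= at_posE Ht (aread_pair f) h1 /= !stepE cats0.
  exact: runs_refl.
have [h2 {}h] := reads_cons h.
rewrite /= (_ : (2 * (size l).+1).+1 = (2 * size l).+1.+2); last lia.
apply: runs_step; rewrite /sstep /= at_posE Ht (aread_pair f) h1 /= !stepE.
apply: runs_step; rewrite /sstep /= at_posE Ht (aread_pair f) h2 /= !stepE.
have := IH (rcons zs b) _ h; rewrite act_rcons // size_rcons cat_rcons.
have -> : amove MoveR (written ys, (size zs)%:Z) =
          (written ys, (size zs).+1%:Z).
  by rewrite /amove /=; congr (_, _); lia.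
by rewrite (_ : z + (size (tagged l)).+2%:Z =
                z + 1 + 1 + (size (tagged l))%:Z)%R //; lia.
Qed.

Definition finishes (T : nat) (c : sconfig) (b : bool) : Prop :=
  exists2 c', runs T c c' &
    halted (s_state c') /\ s_o c' = (written [:: b], 0%R).

Lemma finishes_trans T1 T2 c c' b :
  runs T1 c c' -> finishes T2 c' b -> finishes (T1 + T2) c b.
Proof. by move=> h [c2 h2 H]; exists c2 => //; apply: runs_trans h h2. Qed.

Lemma finishes_leq T T' c b : T <= T' -> finishes T c b -> finishes T' c b.
Proof. by move=> h [c2 h2 H]; exists c2 => //; apply: runs_leq h h2. Qed.

Lemma act_output b : act (Some b, Stay) (written [::], 0%R) = (written [:: b], 0%R).
Proof. by rewrite /act written_rcons. Qed.

(** * One pass: [al y - be d] on binary numerals with a bounded carry *)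

Section Pass.
Variables (first : bool) (ds : seq bool) (sg : bool).
Variables (t : 'I_m.+1 -> atape) (u : atape).

Let al := if first then q else 1.
Let be := if first then p0 else p1.

Let K_gt0 : 0 < K. Proof. by rewrite /K; lia. Qed.
Let al_leq : al <= K. Proof. by rewrite /al /K; case: (first); lia. Qed.
Let be_leq : be <= K. Proof. by rewrite /be /K; case: (first); lia. Qed.

Definition pass_config (e : 'I_(K + K).+1) (zs ys : seq bool) : sconfig :=
  SConfig (inr (if first then PassFirst else PassNext, sg, e)) t u
    (written (zs ++ ys), (size zs)%:Z) (written ds, (size zs)%:Z)
    (written [::], 0%R).

Definition rewind_config (e : 'I_(K + K).+1) (ys : seq bool) : sconfig :=
  SConfig (inr (PassRew, sg, e)) t u
    (written ys, (size ys)%:Z - 1)%R (written ds, (size ys)%:Z - 1)%R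
    (written [::], 0%R).

(* The digits zs are final, the digits ys are not processed yet, and e - K is
   the carry. *)
Definition pass_value (e : nat) (zs ys : seq bool) : int :=
  ((bits_val zs)%:Z + (2 ^ size zs)%N%:Z * (e%:Z - K%:Z
   + al%:Z * (bits_val ys)%:Z
   - be%:Z * (bits_val (drop (size zs) ds))%:Z))%R.

Definition exhausted (zs ys : seq bool) : bool :=
  (size ys == 0) && (size ds <= size zs).

Let blank_pass zs ys :
  blank (aread (written (zs ++ ys), (size zs)%:Z)) &&
  blank (aread (written ds, (size zs)%:Z)) = exhausted zs ys.
Proof. by rewrite !blank_written size_cat /exhausted; lia. Qed.

Lemma pass_value_exhausted e zs ys : exhausted zs ys ->
  pass_value e zs ys =
  ((bits_val zs)%:Z + (2 ^ size zs)%N%:Z * (e%:Z - K%:Z))%R.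
Proof.
case/andP => /nilP -> h; rewrite /pass_value drop_oversize //=; ring.
Qed.

Lemma sstep_pass (e : 'I_(K + K).+1) zs ys :
  ~~ (exhausted zs ys && (e <= K)) ->
  let r := e + al * head false ys + (K - be * nth false ds (size zs)) in
  sstep (pass_config e zs ys) =
  pass_config (inord r./2) (rcons zs (odd r)) (behead ys).
Proof.
move=> he r.
have h1 : [&& blank (aread (written (zs ++ ys), (size zs)%:Z)),
   blank (aread (written ds, (size zs)%:Z)) & e < K] = false.
  by rewrite andbA blank_pass; lia.
have h2 : [&& blank (aread (written (zs ++ ys), (size zs)%:Z)),
   blank (aread (written ds, (size zs)%:Z)) & (e : nat) == K] = false.
  by rewrite andbA blank_pass; lia.
have h3 : e + al * (aread (written (zs ++ ys), (size zs)%:Z) == Some true)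
   + (K - be * (aread (written ds, (size zs)%:Z) == Some true)) = r.
  rewrite !aread_written_true nth_cat ltnn subnn /r.
  by case: (ys).
have h4 : act (Some (odd r), MoveR) (written (zs ++ ys), (size zs)%:Z) =
   (written (rcons zs (odd r) ++ behead ys), (size (rcons zs (odd r)))%:Z).
  case: (ys) => [|a ys'] /=; first by rewrite !cats0 act_rcons // size_rcons.
  by rewrite (act_update _ _ _ (erefl _)) cat_rcons size_rcons.
have h5 : amove MoveR (written ds, (size zs)%:Z) =
   (written ds, (size (rcons zs (odd r)))%:Z).
  by rewrite /amove /= size_rcons; congr (_, _); lia.
have h6 (first' : bool) : halted (inr (if first' then PassFirst else PassNext, sg, e)) = false.
  by case: first'.
rewrite /pass_config -h4 -h5 -h3 {h3 h4 h5} /sstep h6 /al /be.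
by case: (first) => /=; rewrite h1 h2 /= !stepE.
Qed.

(** The sum is at most [2 K + K + K], and halving brings it back to [2 K]. *)
Lemma carry_bound (e a b : nat) : e <= K + K -> a <= 1 -> b <= 1 ->
  (e + al * a + (K - be * b))./2 < (K + K).+1.
Proof.
move=> he ha hb; have : al * a <= K by apply: leq_trans al_leq; nia.
by have := leq_subr (be * b) K; lia.
Qed.

(** [r] is the carry plus the weighted current digits, shifted by [2 K]. Its parity is thus the next
    digit, and [r./2] is the next carry shifted by [K]. *)
Lemma pass_value_step (e : 'I_(K + K).+1) zs ys :
  let r := e + al * head false ys + (K - be * nth false ds (size zs)) in
  pass_value (inord r./2 : 'I_(K + K).+1) (rcons zs (odd r)) (behead ys) =
  pass_value e zs ys.
Proof.
move=> r; rewrite inordK; last first.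
  by apply: carry_bound; rewrite ?leq_b1 // -ltnS ltn_ord.
rewrite /pass_value bits_val_rcons size_rcons expnS (bits_val_drop _ (size zs)).
have -> : bits_val ys = head false ys + 2 * bits_val (behead ys).
  by case: (ys).
set D := bits_val _; set Y := bits_val _; set w := 2 ^ _.
have hb : be * nth false ds (size zs) <= K.
  by apply: leq_trans be_leq; case: nth; rewrite ?muln1 ?muln0.
(* By [hb] the truncated subtraction in [r] is exact, so [e] is recovered from the quotient and the
   remainder of [r] by 2. *)
have hr : (e%:Z = (odd r)%:Z + 2 * (r./2)%:Z - al%:Z * (head false ys)%:Z - K%:Z
      + be%:Z * (nth false ds (size zs))%:Z)%R.
  have := odd_double_half r; rewrite -mul2n {3}/r.
  by move: hb; move: (odd r) r./2 (nth _ _ _) (head _ _) => c h b a; lia.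
rewrite hr !PoszD !PoszM; ring.
Qed.

(** With no digits left, a zero carry means that [zs] is the result. A negative carry outweighs
    [zs], whose value is below [2 ^ size zs], so the result is negative. *)
Lemma runs_pass_exhausted k (e : 'I_(K + K).+1) zs ys :
  exhausted zs ys -> e <= K ->
  if (0 <= pass_value e zs ys)%R then
    exists zs' e', [/\ size zs' <= size zs + k,
      (bits_val zs')%:Z = pass_value e zs ys &
      runs k.+1 (pass_config e zs ys) (rewind_config e' zs')]
  else finishes k.+1 (pass_config e zs ys) (g sg false).
Proof.
move=> hB he; rewrite pass_value_exhausted //.
have hlt := bits_val_lt zs.
have /andP[hy hd] : blank (aread (written (zs ++ ys), (size zs)%:Z)) &&
  blank (aread (written ds, (size zs)%:Z)) by rewrite blank_pass.
have ys0 : ys = [::] by case/andP: hB => /nilP.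
have h6 (first' : bool) :
    halted (inr (if first' then PassFirst else PassNext, sg, e)) = false.
  by case: first'.
move: he; rewrite leq_eqVlt => /orP[/eqP he|he].
  rewrite he subrr mulr0 addr0 /=; exists zs, e; split=> //; first by lia.
  apply: (@runs_leq 1) => //; apply: runs_step.
  rewrite /sstep /pass_config h6.
  case: (first) => /=; rewrite hy hd he ltnn eqxx /= !stepE ys0 cats0;
  exact: runs_refl.
rewrite ifF; last first.
  have [x hx] : exists x, K = e + x.+1 by exists (K - e).-1; lia.
  have -> : (e%:Z - K%:Z = - x.+1%:Z)%R by lia.
  by apply/negbTE; rewrite -ltNge; move: (2 ^ _) hlt => w; nia.
apply: (@finishes_leq 1) => //; eexists; first exact/runs_step/runs_refl.
rewrite /sstep /pass_config h6.
by case: (first) => /=; rewrite hy hd he /= act_output.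
Qed.

(** The quantity bounded by [k] decreases at each step: while digits remain it is their number plus
    [K]; afterwards it is the positive carry [e - K], which halving decreases. As the carry never
    exceeds [K], it also decreases when the digits run out. *)
Lemma runs_pass k (e : 'I_(K + K).+1) zs ys :
  (if exhausted zs ys then e - K
   else maxn (size ys) (size ds - size zs) + K) <= k ->
  if (0 <= pass_value e zs ys)%R then
    exists zs' e', [/\ size zs' <= size zs + k,
      (bits_val zs')%:Z = pass_value e zs ys &
      runs k.+1 (pass_config e zs ys) (rewind_config e' zs')]
  else finishes k.+1 (pass_config e zs ys) (g sg false).
Proof.
elim: k e zs ys => [|k IH] e zs ys hk.
all: have [/andP[hB he]|hn] := boolP (exhausted zs ys && (e <= K)).
all: try exact: runs_pass_exhausted.
  by move: hn hk; case: ifP => /=; lia.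
have := sstep_pass hn; have := pass_value_step e zs ys.
set r := _ + _ => /= hv hs.
have hr : (inord r./2 : 'I_(K + K).+1) = r./2 :> nat.
  by rewrite inordK //; apply: carry_bound; rewrite ?leq_b1 // -ltnS ltn_ord.
have hrK : r./2 < (K + K).+1.
  by apply: carry_bound; rewrite ?leq_b1 // -ltnS ltn_ord.
have hm : (if exhausted (rcons zs (odd r)) (behead ys) then r./2 - K else
    maxn (size (behead ys)) (size ds - size (rcons zs (odd r))) + K) <= k.
  move: hn hk; rewrite /exhausted size_behead size_rcons.
  have [/andP[/nilP ys0 hd]|hB] := boolP ((size ys == 0) && (size ds <= size zs)).
    rewrite {1 2}ys0 /= (leqW hd) => he hk.
    rewrite /r ys0 nth_default // /= !muln0; lia.
  by move=> _ hk; have := hrK; case: ifP; lia.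
have := IH (inord r./2) (rcons zs (odd r)) (behead ys).
rewrite hv hr => /(_ hm) {IH}.
rewrite size_rcons; case: ifP => hv0.
  case=> zs' [e' [h1 h2 h3]]; exists zs', e'; split=> //; first by lia.
  by apply: runs_step; rewrite hs.
case=> c' h1 h2; exists c' => //; apply: runs_step; by rewrite hs.
Qed.

Lemma runs_full_pass ys W :
  size ys <= W -> size ds <= W ->
  let c := SConfig
    (inr (if first then PassFirst else PassNext, sg, inord K : 'I_(K + K).+1))
    t u (written ys, 0%R) (written ds, 0%R) (written [::], 0%R) in
  if be * bits_val ds <= al * bits_val ys then
    exists zs e, [/\ size zs <= W + K,
      bits_val zs = al * bits_val ys - be * bits_val ds &
      runs ((W + K).+1 + (W + K).+1) c
        (SConfig (inr (Round, sg, e)) t u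
          (written zs, 0%R) (written ds, 0%R) (written [::], 0%R))]
  else finishes (W + K).+1 c (g sg false).
Proof.
move=> hy hd c.
have hK : (inord K : 'I_(K + K).+1) = K :> nat.
  by rewrite inordK // ltnS leq_addr.
have := @runs_pass (W + K) (inord K) [::] ys.
rewrite /pass_config /pass_value /= hK expn0 drop0 subn0 subnn -/c.
have -> : (if exhausted [::] ys then 0 else maxn (size ys) (size ds) + K)
    <= W + K by case: ifP => _ //; lia.
have -> : (0%Z + 1%Z * (K%:Z - K%:Z + al%:Z * (bits_val ys)%:Z -
    be%:Z * (bits_val ds)%:Z) = (al * bits_val ys)%N%:Z -
    (be * bits_val ds)%N%:Z)%R by rewrite !PoszM; ring.
move=> /(_ isT); case: leqP => hv; last by rewrite ifF //; lia.
rewrite ifT; last by lia.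
case=> zs [e [h1 h2 h3]].
have [e' h4] := @runs_rewind PassRew Round sg e t u zs ds
  (written [::], 0%R) (size zs) (or_intror (or_intror erefl)) (leq_maxl _ _).
exists zs, e'; split; [by lia|by lia|].
by apply: runs_trans h3 (runs_leq _ h4); lia.
Qed.

End Pass.

(** [r] counts the marks of [n] still to be consumed. A pass with a negative result decides the
    comparison, since later rounds would only subtract more. Each pass may lengthen the first
    operand by [K] digits, hence [W + r * K]. *)
Lemma runs_rounds n ds t sg r : forall i ys W (e : 'I_(K + K).+1),
  i + r = n -> size ys <= W -> size ds <= W ->
  finishes (r.+1 * (2 * (W + r * K) + 4))
    (SConfig (inr (Round, sg, e)) t (written (nseq n true), i%:Z)
       (written ys, 0%R) (written ds, 0%R) (written [::], 0%R))
    (g sg (r * p1 * bits_val ds <= bits_val ys)).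
Proof.
elim: r => [|r IH] i ys W e hi hy hd.
  apply: (@finishes_leq 1); first by lia.
  eexists; first exact/runs_step/runs_refl.
  by rewrite /sstep /= blank_written size_nseq (_ : n <= i) ?act_output //; lia.
pose T1 := 1 + ((W + K).+1 + (W + K).+1 + r.+1 * (2 * (W + K + r * K) + 4)).
apply: (@finishes_leq T1); first by rewrite /T1; nia.
apply: finishes_trans (runs_step (runs_refl _)) _.
rewrite {1}/sstep /= blank_written size_nseq leqNgt (_ : i < n) /=; last lia.
rewrite !stepE /amove /= (_ : (i%:Z + 1)%R = i.+1%:Z); last lia.
have := runs_full_pass false sg t (written (nseq n true), i.+1%:Z) hy hd.
rewrite mul1n /=; case: leqP => hv.
  case=> zs [e' [h1 h2 h3]]; apply: finishes_trans h3 _.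
  have -> : (r.+1 * p1 * bits_val ds <= bits_val ys) =
            (r * p1 * bits_val ds <= bits_val zs).
    by rewrite h2 mulSn mulnDl; lia.
  by apply: IH; lia.
rewrite (_ : (_ <= _) = false); last by rewrite mulSn mulnDl; lia.
by apply: finishes_leq; lia.
Qed.

Lemma at_pos_id x z (t : 'I_m.+1 -> atape) : (t x).2 = z -> at_pos x z t = t.
Proof.
by move=> <-; apply/funext => i; rewrite /at_pos; case: eqP => // ->; case: (t x).
Qed.

Lemma finishes_parsed n t z sg u (e : 'I_(K + K).+1) (la lb : seq bool) :
  (t ord_max).2 = z -> u = (written (nseq n true), 0%R) ->
  reads (t ord_max).1 z (sg :: tagged la ++ tagged lb) ->
  let l := size la + size lb in
  finishes (6 * l + 2 * K + 7 + n.+1 * (2 * (l + K + n * K) + 4))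
    (SConfig (inr (Sign, false, e)) t u
      (written [::], 0%R) (written [::], 0%R) (written [::], 0%R))
    (g sg ((p0 + n * p1) * bits_val lb <= q * bits_val la)).
Proof.
move=> hz -> /reads_cons[h0 hr] l.
have [hra hrb] : reads (t ord_max).1 (z + 1)%R (tagged la) /\
    reads (t ord_max).1 (z + 1 + (size (tagged la))%:Z)%R (tagged lb).
  split=> j hj; first rewrite hr.
  - by rewrite nth_cat hj.
  - by rewrite size_cat ltn_addr.
  rewrite -addrA -PoszD hr; first by rewrite nth_cat ltnNge leq_addr addKn.
  by rewrite size_cat ltn_add2l.
(* In order: the sign, the numerator and its rewinding, the denominator and its rewinding, the first
   pass with its rewinding, the rounds. *)
pose T1 := 1 + ((2 * size la).+1 + ((size la).+1 + ((2 * size lb).+1 +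
  ((size lb).+1 + ((l + K).+1 + (l + K).+1 +
  n.+1 * (2 * (l + K + n * K) + 4)))))).
apply: (@finishes_leq T1); first by rewrite /T1 /l; lia.
apply: finishes_trans (runs_step (runs_refl _)) _.
rewrite -(at_pos_id hz) /sstep /= at_posE aread_pair h0 !stepE /=.
rewrite (_ : (Some sg == Some true) = sg); last by case: (sg).
apply: finishes_trans (runs_num [::] _ _ _ _ (erefl _) hra) _.
rewrite cat0s.
have [e1] := @runs_rewind NumRew DenTag sg e
  (at_pos ord_max (z + 1 + size (tagged la)) t)
  (written (nseq n true), 0%R) la [::] (written [::], 0%R) _
  (or_introl erefl) (leq_maxl _ _).
move/finishes_trans; apply.
apply: finishes_trans (runs_den [::] _ _ _ _ _ (erefl _) hrb) _.
rewrite cat0s.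
have [e2] := @runs_rewind DenRew PassFirst sg e1
  (at_pos ord_max (z + 1 + size (tagged la) + size (tagged lb)) t)
  (written (nseq n true), 0%R) la lb (written [::], 0%R) _
  (or_intror (or_introl erefl)) (leq_maxr _ _).
move/finishes_trans; apply.
have hla : size la <= l by rewrite leq_addr.
have hlb : size lb <= l by rewrite leq_addl.
have := runs_full_pass true sg
  (at_pos ord_max (z + 1 + size (tagged la) + size (tagged lb)) t)
  (written (nseq n true), 0%R) hla hlb.
rewrite /=; case: leqP => hv.
  case=> zs [e' [h1 h2 h3]]; apply: finishes_trans h3 _.
  have -> : ((p0 + n * p1) * bits_val lb <= q * bits_val la) =
            (n * p1 * bits_val lb <= bits_val zs).
    by rewrite h2 mulnDl; lia.
  by apply: (@runs_rounds n _ _ _ n 0) => //; lia.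
rewrite (_ : (_ <= _) = false); last by rewrite mulnDl; lia.
by apply: finishes_leq; lia.
Qed.

Lemma flat_init w :
  ainit threshold_tm w = flat (SConfig (inr (Copy, false, ord0)) (ainit M w).2
    (written [::], 0%R) (written [::], 0%R) (written [::], 0%R)
    (written [::], 0%R)).
Proof.
congr (_, _); apply/funext => i /=.
case: (@splitP m.+1 4 i) => j hj.
  by rewrite -!val_eqE /= hj.
rewrite -val_eqE /= hj; case: j {hj} => [[|[|[|j]]] hj] //=.
by rewrite nth_nil.
Qed.

(** [polytime] prescribes an exact time; a halted configuration no longer changes, so every time
    from [T] on will do. *)
Lemma finishes_computes w T o :
  finishes T (SConfig (inr (Copy, false, ord0)) (ainit M w).2
    (written [::], 0%R) (written [::], 0%R) (written [::], 0%R)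
    (written [::], 0%R)) o ->
  forall T', T <= T' -> tm_computes_within threshold_tm w T' [:: o].
Proof.
case=> c' [i hi hc] [hh ho] T' hT.
have hflat k c : iter k (@astep threshold_tm) (flat c) = flat (iter k sstep c).
  by elim: k => //= k ->; rewrite astep_flat.
have hiter : iter T' (@astep threshold_tm) (ainit threshold_tm w) = flat c'.
  rewrite -(subnK (leq_trans hi hT)) iterD flat_init hflat hc.
  exact: iter_halted.
apply/computes_within_astep => /=; rewrite hiter; split=> // j hj.
have -> : (flat c').2 ord_max = s_o c'.
  rewrite /=; case: (@splitP m.+1 4 ord_max) => k /= hk.
    have {}hk : m + 4 = k := hk.
    by have := ltn_ord k; lia.
  have {}hk : m + 4 = m.+1 + k := hk.
  have -> : k = 3 :> nat by lia.
  by [].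
by rewrite ho add0r.
Qed.

Lemma threshold_tm_correct n w T sg a b :
  tm_computes_within M (nseq n true ++ false :: w) T
    (sg :: enc_nat a ++ enc_nat b) ->
  forall T', 10 * (n.+1 * (n.+1 * K + T + size w + 1)) <= T' ->
  tm_computes_within threshold_tm (nseq n true ++ false :: w) T'
    [:: g sg ((p0 + n * p1) * b <= q * a)].
Proof.
move=> hM T' hT'; have hsize := size_tm_output M (nseq n true ++ false :: w) T.
have [_ ho] := hM; rewrite ho {ho} in hsize.
have [hh ho] := (computes_within_astep _ _ _ _).1 hM.
have hs := runs_simulation (written (nseq n true), 0%R) (written [::], 0%R)
  (written [::], 0%R) (written [::], 0%R) hh.
pose t := (ainit M (nseq n true ++ false :: w)).2.
move: hh ho hs; set c := iter T _ _ => hh ho hs.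
have ht : (t ord0).1 = written (nseq n true ++ false :: w) by [].
have ht0 : at_pos ord0 0%R t = t by apply: at_pos_id.
set la := nat_bits a; set lb := nat_bits b.
have hr : reads (c.2 ord_max).1 (c.2 ord_max).2 (sg :: tagged la ++ tagged lb).
  move=> j hj; rewrite ho; last exact: ltnW.
  by rewrite (nth_map false).
have hp := finishes_parsed ord0 (erefl _) (erefl _) hr.
rewrite -[a]nat_bitsK -[b]nat_bitsK -/la -/lb.
have htag (s : seq bool) : size (tagged s) = (2 * size s).+1.
  by rewrite /tagged size_cat; elim: s => //= x s; lia.
(* The output of [M] has two cells per bit, a terminator for each of the two numbers, and the
   sign. *)
have hl : 2 * (size la + size lb) + 3 <= n + size w + 1 + T.*2.
  have : size (sg :: tagged la ++ tagged lb) <=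
    size (nseq n true ++ false :: w) + T.*2 := hsize.
  by rewrite /= [size (tagged _ ++ _)]size_cat !htag size_cat size_nseq /=; lia.
pose T1 := n.+1 + (n.+1 + (T.+1 + (6 * (size la + size lb) + 2 * K + 7 +
  n.+1 * (2 * (size la + size lb + K + n * K) + 4)))).
apply: (@finishes_computes _ T1).
  have := @runs_copy n w false ord0 t (written [::], 0%R) (written [::], 0%R)
    (written [::], 0%R) ht n 0 (erefl n).
  rewrite ht0; move/finishes_trans; apply.
  have := @runs_back n false ord0 t (written [::], 0%R) (written [::], 0%R)
    (written [::], 0%R) n (leqnn n).
  by rewrite ht0; move/finishes_trans; apply; apply: finishes_trans hs _.
apply: leq_trans hT'; rewrite /T1.
have K_gt0 : 0 < K by rewrite /K; lia.
have : n.+1 * 1 <= n.+1 * K by rewrite leq_mul2l K_gt0.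
have : n.+1 * (n.+1 * 1) <= n.+1 * (n.+1 * K) by rewrite !leq_mul2l K_gt0.
have : n.+1 * (2 * (size la + size lb)) <= n.+1 * (n + size w + 1 + T.*2).
  by rewrite leq_mul2l; lia.
have : 1 * (T + size w) <= n.+1 * (T + size w) by rewrite leq_mul2r orbT.
have : 1 * K <= n.+1 * K by rewrite leq_mul2r orbT.
have : 1 * (n.+1 * K) <= n.+1 * (n.+1 * K) by rewrite leq_mul2r orbT.
rewrite -mul2n in hl *.
set l := size la + size lb in hl *.
lia.
Qed.

End Threshold.

(** * Polynomial-time comparison with a rational threshold *)

Lemma polytime_threshold (I : nat -> Type) (encI : forall n, I n -> seq bool)
    (f : forall n, I n -> rat) (g : bool -> bool -> bool) (q p0 p1 : nat) :
  0 < q ->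
  (forall n x, exists w, encI n x = nseq n true ++ false :: w) ->
  polytime encI enc_rat f ->
  polytime encI (fun b : bool => [:: b])
    (fun n x => g (numq (f n x) < 0)%R
       ((p0 + n * p1) * `|denq (f n x)| <= q * `|numq (f n x)|)).
Proof.
move=> q_gt0 hI [M [c hM]]; set K := q + p0 + p1.
(* For inputs of length [N], the running time is at most [10 (K + 2 c + 1) N ^ (c + 2)]; a single
   constant has to serve as both coefficient and exponent. *)
exists (threshold_tm M g q p0 p1), (10 * (K + 2 * c + 1) + c + 2) => n x.
have [w hw] := hI n x; have := hM n x; rewrite hw => hx.
apply: (@threshold_tm_correct M g q p0 p1 q_gt0 n w _ (numq (f n x) < 0)%R _ _ hx).
set N := size _.
have hN : N = n + (size w).+1 by rewrite /N size_cat size_nseq.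
set T := c * N ^ c + c.
have N_gt0 : 0 < N by rewrite hN; lia.
apply: (@leq_trans (10 * (N * (N * K + T + N)))).
  have h1 : n.+1 <= N by lia.
  rewrite leq_mul2l /= leq_mul //.
  have := leq_mul h1 (leqnn K); rewrite -/K; lia.
apply: (@leq_trans (10 * (K + 2 * c + 1) * N ^ c.+2)).
  rewrite -mulnA leq_mul2l /= [N ^ c.+2]expnS mulnCA leq_mul2l; apply/orP; right.
  have h : N <= N ^ c.+1 by rewrite expnS leq_pmulr // expn_gt0 N_gt0.
  have h1 : 1 <= N ^ c.+1 by apply: leq_trans h.
  have h2 : N ^ c <= N ^ c.+1 by rewrite leq_pexp2l.
  have := leq_mul (leqnn K) h; have := leq_mul (leqnn c) h1.
  have := leq_mul (leqnn c) h2; rewrite /T; lia.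
apply: leq_trans (leq_addr _ _); apply: leq_mul; first by lia.
by rewrite leq_pexp2l //; lia.
Qed.

Lemma normr_divq (x : rat) : (`|x| * `|denq x|%N%:R = `|numq x|%N%:R)%R.
Proof.
have hd : (`|denq x|%N%:R = (denq x)%:~R :> rat)%R.
  by rewrite pmulrn gez0_abs // denq_ge0.
rewrite hd -{1}[x]divq_num_den normrM normfV [X in (_ / X)%R]ger0_norm; last first.
  by rewrite ler0z denq_ge0.
rewrite divfK ?intr_eq0 ?denq_neq0 // -intr_norm pmulrn abszE //.
Qed.

(** Ties are left open: the threshold will lie strictly between the two cases to be separated. *)
Lemma polytime_compare (I : nat -> Type) (encI : forall n, I n -> seq bool)
    (f : forall n, I n -> rat) (r : rat) (scaled : bool) :
  (forall n x, exists w, encI n x = nseq n true ++ false :: w) ->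
  polytime encI enc_rat f ->
  exists2 t : forall n, I n -> bool,
    polytime encI (fun b : bool => [:: b]) t &
    forall n x, let y := (r * (if scaled then n%:R else 1))%R in
      (y < f n x -> t n x)%R /\ (f n x < y -> ~~ t n x)%R.
Proof.
move=> hI hf; set a := `|numq r|.
(* The threshold is built into the machine: its numerator is [p1], multiplied by [n], if [scaled]
   holds, and [p0] otherwise. *)
set p0 := if scaled then 0 else a; set p1 := if scaled then a else 0.
have q_gt0 : 0 < `|denq r| by rewrite absz_gt0 denq_neq0.
(* The machine compares absolute values only. If [r >= 0], negative outputs are rejected; if
   [r < 0], an output is rejected only when it is negative and of large absolute value. *)
pose g := if (0 <= r)%R then fun s c => ~~ s && c else fun s c => ~~ (s && c).
eexists; first exact: (polytime_threshold g p0 p1 q_gt0 hI hf).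
move=> n x /=; set y := f n x; set s : rat := if _ then _ else _.
have s_ge0 : (0 <= s)%R by rewrite /s; case: ifP.
have -> : ((p0 + n * p1) * `|denq y| <= `|denq r| * `|numq y|) =
          (`|r| * s <= `|y|)%R.
  rewrite -(ler_nat rat) !natrM -!normr_divq.
  have -> : ((p0 + n * p1)%N%:R = `|r| * `|denq r|%N%:R * s)%R.
    rewrite normr_divq /p0 /p1 /s -/a natrD natrM.
    by case: (scaled); rewrite ?mulr0 ?mulr1 ?add0r ?addr0 // mulrC.
  have hd : (0 < `|denq y|%N%:R :> rat)%R by rewrite ltr0n absz_gt0 denq_neq0.
  have hq : (0 < `|denq r|%N%:R :> rat)%R by rewrite ltr0n.
  rewrite -[RHS](ler_pM2r (mulr_gt0 hq hd)).
  by congr (_ <= _)%R; ring.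
rewrite numq_lt0 /g; case: (leP 0%R r) => hr.
  rewrite (ger0_norm hr); have := mulr_ge0 hr s_ge0.
  by case: (ltP y 0%R) => hy /=; [split; lra | rewrite ger0_norm //; split; lra].
rewrite (ltr0_norm hr); have := mulr_ge0 (ltW (_ : 0 < - r)%R) s_ge0.
rewrite oppr_gt0 => /(_ hr); rewrite mulNr.
by case: (ltP y 0%R) => hy /=; [rewrite ltr0_norm //; split; lra | split; lra].
Qed.

Local Open Scope ring_scope.

(** * Cuts of planted and noisy graphs *)

Lemma set2_eqE (T : finType) (a b u v : T) :
  ([set u; v] == [set a; b]) =
  ((u == a) && (v == b)) || ((u == b) && (v == a)).
Proof.
apply/eqP/orP => [/setP H|[/andP[/eqP -> /eqP ->]|/andP[/eqP -> /eqP ->]]] //.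
  have := (H a, H b, H u, H v); rewrite !inE !eqxx /= !orbT.
  move=> [[[ha hb] hu] hv].
  move: ha hb hu hv; rewrite ![a == _]eq_sym ![b == _]eq_sym.
  by case: (u == a); case: (u == b); case: (v == a); case: (v == b); auto.
by rewrite finset.setUC.
Qed.

(** Double counting of the ordered pairs of adjacent vertices. *)
Lemma handshake n (F : {set {set 'I_n}}) :
  simple_edges F -> (\sum_v #|nbrs F v| = 2 * #|F|)%N.
Proof.
move=> /forall_inP simpleF.
have -> : (\sum_v #|nbrs F v| =
    \sum_(p : 'I_n * 'I_n) ([set p.2; p.1] \in F))%N.
  rewrite (eq_bigr (fun v => \sum_u ([set u; v] \in F : nat))%N); last first.
    by move=> v _; rewrite -sum1_card big_mkcond; apply: eq_bigr => u _; rewrite inE.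
  by rewrite pair_bigA.
rewrite (eq_bigr (fun p => \sum_(e in F) ([set p.2; p.1] == e : nat))%N).
  rewrite exchange_big (eq_bigr (fun=> 2%N)); first by rewrite sum_nat_const mulnC.
  move=> e he; have /cards2P[a [b [ab ->]]] := simpleF e he.
  rewrite (eq_bigr (fun p => p \in [set (b, a); (a, b)] : nat)); last first.
    by move=> [u v] _; rewrite set2_eqE !inE !xpair_eqE /= orbC; 
      congr (nat_of_bool _); rewrite ![(v == _) && _]andbC orbC.
  by rewrite -big_mkcond sum1_card cards2 xpair_eqE eq_sym (negbTE ab).
move=> p _; case: (boolP (_ \in F)) => h.
  rewrite (bigD1 _ h) /= eqxx big1 // => e /andP[_].
  by rewrite eq_sym => /negbTE ->.
by rewrite big1 // => e he; case: eqP h => // ->; rewrite he.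
Qed.

Lemma simple_cut_edges n k (s : {ffun 'I_n -> 'I_k}) (G : sgraph n) :
  simple_edges (cut_edges s G).
Proof.
apply/forall_inP => e; rewrite inE => /andP[he _].
by have /forall_inP := valP G; apply.
Qed.

Lemma nbrs_cut_edges n k (s : {ffun 'I_n -> 'I_k}) (G : sgraph n) v :
  nbrs (cut_edges s G) v = [set u in nbrs (edges G) v | s u != s v].
Proof.
apply/setP => u; rewrite !inE; congr (_ && _).
apply/exists_inP/idP => [[x hx /exists_inP[y hy]]|h].
  move: hx hy; rewrite !inE.
  by move=> /orP[] /eqP -> /orP[] /eqP ->; rewrite ?eqxx // eq_sym.
exists u; first by rewrite !inE eqxx.
by apply/exists_inP; exists v; rewrite // !inE eqxx orbT.
Qed.

(** An ordered pair of adjacent vertices contributes [1 / (k - 1)], that is [k / (k - 1) - 1], to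
    the inner product if it is cut, and [- 1] otherwise. *)
Lemma Gamma_geq_cut (R : realType) n k (s : {ffun 'I_n -> 'I_k}) (G : sgraph n) :
  (2 <= k)%N ->
  k%:R / (k%:R - 1) * (2 * #|cut_edges s G|)%N%:R - (2 * #|edges G|)%N%:R
  <= Gamma k (adjmx R G).
Proof.
move=> k2.
have k1 : (k%:R - 1 : R) != 0 by rewrite subr_eq0 (eqr_nat R k 1); lia.
apply: (@le_trans _ _ (mx_inner (partition_mx R s) (- adjmx R G))).
  rewrite -!handshake ?simple_cut_edges ?(valP G) //.
  rewrite /mx_inner !natr_sum mulr_sumr -sumrB; apply: ler_sum => v _.
  have card_sum (A : {set 'I_n}) : #|A|%:R = \sum_u (u \in A)%:R :> R.
    rewrite -sum1_card natr_sum big_mkcond; apply: eq_bigr => u _.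
    by case: ifP.
  rewrite !card_sum mulr_sumr -sumrB; apply: ler_sum => u _.
  rewrite nbrs_cut_edges !mxE !inE [[set v; u]]finset.setUC eq_sym.
  case: (_ \in _) => /=; last by rewrite !mulr0 subr0 oppr0 mulr0.
  case: eqP => _ /=; first by rewrite mulr0 mul1r; lra.
  by rewrite le_eqVlt; apply/orP; left; apply/eqP; field.
apply: sup_ubound; last by exists s.
(* [sup_ubound] asks for some upper bound of the set; the sum of all absolute values is one. *)
exists (\sum_(s' : {ffun 'I_n -> 'I_k})
  `|mx_inner (partition_mx R s') (- adjmx R G)|) => _ [s' _ <-].
rewrite (bigD1 s') //= -[leLHS]addr0; apply: lerD; first exact: ler_norm.
by apply: sumr_ge0.
Qed.

Lemma MC_geq_cut (R : realType) n k (s : {ffun 'I_n -> 'I_k}) (G : sgraph n) :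
  #|cut_edges s G|%:R / #|edges G|%:R <= MC R k G.
Proof.
apply: ler_wpM2r; first by rewrite invr_ge0.
by rewrite ler_nat (leq_bigmax s).
Qed.

(** * Supports of the planted and noisy laws *)

Lemma unif_neq0 (R : realType) (T : finType) (A : {set T}) x :
  unif R A x != 0 -> x \in A.
Proof. by rewrite /unif; case: (x \in A); rewrite // mul0r eqxx. Qed.

Lemma sumr_neq0_witness (R : realType) (T : finType) (F : T -> R) :
  \sum_x F x != 0 -> exists x, F x != 0.
Proof.
move=> h; apply: contrapT => H; case/eqP: h; apply: big1 => x _.
by apply/eqP/negPn/negP => hx; apply: H; exists x.
Qed.

(** A graph of nonzero mass has, for some [s], all its blocks among the admissible ones, which fixes
    the degree of each vertex into each class. *)
Lemma eSBM_class_degree (R : realType) d k (eta : R) n (G : sgraph n) :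
  eSBM d k eta G != 0 ->
  exists s : {ffun 'I_n -> 'I_k}, forall v j,
    #|[set u in nbrs (edges G) v | s u == j]|%:R
    = d%:R * sbm_mx k eta (s v) j.
Proof.
move=> /sumr_neq0_witness[s]; rewrite mulf_eq0 negb_or => /andP[_ hs].
exists s => v j.
have block_degree (a b : 'I_k) : (a <= b)%N -> s v \in [set a; b] ->
    #|nbrs (block s a b (edges G)) v|%:R = d%:R * sbm_mx k eta a b.
  move=> hab hv; move/prodf_neq0: hs => /(_ a isT) /prodf_neq0 /(_ b hab).
  move/unif_neq0; rewrite inE => /and3P[_ _ /forallP /(_ v)].
  by rewrite hv => /eqP.
have -> : [set u in nbrs (edges G) v | s u == j] =
    nbrs (block s (s v) j (edges G)) v.
  apply/setP => u; rewrite !inE; congr (_ && _).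
  have -> : [set s x | x in [set u; v]] = [set s u; s v].
    by rewrite finset.imsetU !imset_set1.
  by rewrite set2_eqE eqxx andbT; case: (s u =P s v) => [->|] //=; rewrite orbb.
(* The product in [eSBM] runs over [i <= j] only; the other case follows from the symmetry of
   [block] and [sbm_mx]. *)
have [hj|hj] := leqP (s v) j; first by rewrite block_degree // !inE eqxx.
have -> : block s (s v) j (edges G) = block s j (s v) (edges G).
  by apply/setP => e; rewrite !inE [[set s v; j]]finset.setUC.
rewrite block_degree; [|exact: ltnW|by rewrite !inE eqxx orbT].
by rewrite !mxE eq_sym.
Qed.

(** Each vertex has [d (1 - eta) / k] neighbours in each of the [k - 1] other classes and [d eta]
    more than that in its own, [d] in total. Summing over the vertices counts each edge twice. *)
Lemma eSBM_cut (R : realType) d k (eta : R) n (G : sgraph n) :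
  (2 <= k)%N -> eSBM d k eta G != 0 ->
  exists s : {ffun 'I_n -> 'I_k},
    (2 * #|edges G|)%N%:R = n%:R * d%:R :> R /\
    (2 * #|cut_edges s G|)%N%:R =
      n%:R * d%:R * ((k%:R - 1) / k%:R * (1 - eta)) :> R.
Proof.
move=> k2 /eSBM_class_degree[s hs]; exists s.
have k0 : (k%:R : R) != 0 by rewrite pnatr_eq0; lia.
have k1 : k.-1%:R = k%:R - 1 :> R by rewrite -subn1 natrB //; lia.
have split_degree (P : pred 'I_k) v :
    #|[set u in nbrs (edges G) v | P (s u)]|%:R =
    \sum_(j | P j) d%:R * sbm_mx k eta (s v) j.
  under eq_bigr do rewrite -hs -sum1_card natr_sum.
  rewrite -sum1_card natr_sum (partition_big s P) /=; last first.
    by move=> u; rewrite inE => /andP[].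
  apply: eq_bigr => j Pj; apply: eq_bigl => u; rewrite !inE.
  by case: (s u =P j) => [->|]; rewrite ?Pj ?andbF ?andbT.
have other v j : j != s v -> d%:R * sbm_mx k eta (s v) j =
    d%:R * ((1 - eta) / k%:R).
  by move=> hj; rewrite !mxE eq_sym (negbTE hj) mulr0n add0r mulr1.
have cut_degree v : #|nbrs (cut_edges s G) v|%:R =
    d%:R * ((k%:R - 1) / k%:R * (1 - eta)).
  rewrite nbrs_cut_edges (split_degree (fun j => j != s v)).
  rewrite (eq_bigr _ (other v)) sumr_const.
  have -> : #|[pred j | j != s v]| = k.-1.
    by rewrite cardC1 card_ord.
  rewrite -[_ *+ k.-1]mulr_natr k1.
  by field.
have degree v : #|nbrs (edges G) v|%:R = d%:R :> R.
  have -> : nbrs (edges G) v = [set u in nbrs (edges G) v | predT (s u)].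
    by apply/setP => u; rewrite !inE andbT.
  rewrite split_degree (bigD1 (s v)) //= (eq_bigr _ (other v)) sumr_const.
  have -> : #|[pred j | j != s v]| = k.-1.
    by rewrite cardC1 card_ord.
  rewrite -[_ *+ k.-1]mulr_natr k1.
  by rewrite !mxE eqxx mulr1n mulr1; field.
split; rewrite -handshake ?simple_cut_edges ?(valP G) // natr_sum.
  by rewrite (eq_bigr _ (fun v _ => degree v)) sumr_const card_ord mulr_natl.
rewrite (eq_bigr _ (fun v _ => cut_degree v)) sumr_const card_ord.
by rewrite -[LHS]mulr_natl mulrA.
Qed.

(** Only the two removed edges can leave the cut, and at most two edges replace them. If [insubd]
    falls back on [G], both bounds are trivial. *)
Lemma swap_cut n k (s : {ffun 'I_n -> 'I_k}) (G : sgraph n) q :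
  q \in swaps G ->
  (#|cut_edges s G| <= #|cut_edges s (swap G q)| + 2)%N /\
  (#|edges (swap G q)| <= #|edges G|)%N.
Proof.
case: q => [[i j] [l m]]; rewrite inE => /and5P[h1 h2 h12 _ _].
rewrite /swap; set e1 := [set i; j] in h1 h12 *; set e2 := [set l; m] in h2 h12 *.
set X := _ :|: _.
have hX : (#|X| <= #|edges G|)%N.
  have sub : [set e1; e2] \subset edges G.
    by apply/fintype.subsetP => e; rewrite !inE => /orP[] /eqP ->.
  have := subset_leq_card sub; have := cardsDS sub; rewrite cards2 h12 /= => c1 c2.
  have := cardsU (edges G :\: [set e1; e2]) [set [set i; l]; [set j; m]].
  rewrite -/X c1 cards2; have := leq_b1 ([set i; l] != [set j; m]).
  move: c2; move: (nat_of_bool _) #|_ :&: _| #|X| #|edges G| => *; lia.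
have edgesE : edges (insubd G X) = if simple_edges X then X else edges G.
  exact: val_insubd.
rewrite edgesE; case: ifP => hs; last first.
  by split=> //; rewrite /cut_edges edgesE hs leq_addr.
split=> //; rewrite /cut_edges edgesE hs.
have sub : cut_edges s G \subset cut_edges s (insubd G X) :|: [set e1; e2].
  apply/fintype.subsetP => e; rewrite !inE edgesE hs !inE => /andP[-> ->].
  by rewrite !andbT; case: (e == e1); case: (e == e2); rewrite ?orbT.
apply: leq_trans (subset_leq_card sub) _; rewrite cardsU /cut_edges edgesE hs.
by rewrite cards2; case: (e1 != e2); lia.
Qed.

Lemma noise_support (R : realType) (delta : R) n (p : sgraph n -> R) H :
  noise delta p H != 0 ->
  exists2 G, p G != 0 & forall k (s : {ffun 'I_n -> 'I_k}),
    (#|cut_edges s G| <= #|cut_edges s H| + 2 * Num.truncn (delta * n%:R))%N /\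
    (#|edges H| <= #|edges G|)%N.
Proof.
rewrite /noise; elim: (Num.truncn _) H => [|t IH] H.
  by move=> hp; exists H => // k s; rewrite addn0.
rewrite iterS => /sumr_neq0_witness[G]; rewrite mulf_eq0 negb_or.
case/andP => /IH[G0 hG0 hcut] hk; exists G0 => // k s.
have [c1 c2] := hcut k s.
move: hk; rewrite /swap_kernel; case: ifP => _.
  by case: (H =P G) => [->|_]; [lia | rewrite eqxx].
rewrite /Pr big_mkcond => /sumr_neq0_witness[q].
case: ifP => [/eqP <- /unif_neq0|]; last by rewrite eqxx.
by move=> /(swap_cut s)[c3 c4]; lia.
Qed.

(** The 4 comes from two cut edges lost per swap, each counted twice. The bound holds on the whole
    support, not just with high probability. *)
Lemma noisy_eSBM_cut (R : realType) d k (eta delta : R) n (H : sgraph n) :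
  (2 <= k)%N -> 0 <= delta -> noisy_eSBM d k eta delta H != 0 ->
  exists s : {ffun 'I_n -> 'I_k},
    (2 * #|edges H|)%N%:R <= n%:R * d%:R :> R /\
    n%:R * d%:R * ((k%:R - 1) / k%:R * (1 - eta)) - 4 * delta * n%:R
    <= (2 * #|cut_edges s H|)%N%:R :> R.
Proof.
move=> k2 delta_ge0 /noise_support[G /(eSBM_cut k2)[s [<- <-]] hH].
exists s; have [hcut hE] := hH k s; split; first by rewrite ler_nat leq_mul2l.
have ht : (Num.truncn (delta * n%:R))%:R <= delta * n%:R.
  by rewrite Num.Theory.truncn_le // mulr_ge0.
move: hcut; rewrite -(ler_nat R) natrD !natrM => hcut; lra.
Qed.

(** * Distinguishing from certificates *)

(** With [x = eta ^+ 2], squaring the hypothesis gives [d ^ 2 x < 4 (d - 1)]. If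
    [d x >= 2 (1 + sqrt (1 - x))], isolating the root and squaring gives
    [4 (1 - x) <= (d x - 2) ^ 2], which after division by [x] is the reverse inequality. *)
Lemma lt_dKS (R : realType) d (eta : R) :
  (0 < d)%N -> -1 <= eta -> eta <= 0 ->
  `|eta| < 2 * Num.sqrt (d%:R - 1) / d%:R -> (d%:R%:E < dKS eta)%E.
Proof.
move=> d0 eta_ge eta_le h; rewrite /dKS; case: eqP => [_|/eqP eta0].
  exact: ltry.
have dR : 1 <= d%:R :> R by rewrite ler1n.
have x_gt0 : 0 < eta ^+ 2 by rewrite exprn_even_gt0.
have x_le1 : eta ^+ 2 <= 1.
  by rewrite -[eta]opprK sqrrN exprn_ile1 //; lra.
have hs : 0 <= 1 - eta ^+ 2 by lra.
have hd1 : 0 <= d%:R - 1 :> R by lra.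
have quad : d%:R ^+ 2 * eta ^+ 2 < 4 * (d%:R - 1).
  have : (`|eta| * d%:R) ^+ 2 < (2 * Num.sqrt (d%:R - 1)) ^+ 2.
    by rewrite ltrXn2r // ?nnegrE ?mulr_ge0 ?sqrtr_ge0 // -ltr_pdivlMr ?ltr0n.
  by rewrite !exprMn sqr_sqrtr // real_normK ?num_real //; lra.
rewrite lte_fin mulrAC ltr_pdivlMr // ltNge; apply/negP => hge.
have := sqrtr_ge0 (1 - eta ^+ 2); have := sqr_sqrtr hs.
move: (Num.sqrt _) hge => w hge hw w_ge0.
have : (2 * w) ^+ 2 <= (d%:R * eta ^+ 2 - 2) ^+ 2.
  by rewrite lerXn2r // ?nnegrE; lra.
move: x_gt0 quad hge hw; move: (eta ^+ 2) (d%:R : R) => x D x_gt0 quad _ hw.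
rewrite exprMn hw; nra.
Qed.

(** Without any [d]-regular graph the sum is 0, hence only an inequality. *)
Lemma Pr_Gnd_leq1 (R : realType) d n : \sum_G @Gnd R d n G <= 1.
Proof.
rewrite /Gnd /unif -mulr_suml -natr_sum -big_mkcond sum1_card.
have [->|h] := eqVneq (#|[set G : sgraph n | regular d G]|) 0%N.
  by rewrite mul0r.
by rewrite divff // pnatr_eq0.
Qed.

Lemma Gnd_ge0 (R : realType) d n (G : sgraph n) : 0 <= Gnd R d G.
Proof. by rewrite divr_ge0. Qed.

Lemma within_subset (T : Type) (F : set_system T) (FF : Filter F)
    (D D' : set T) :
  (D `<=` D' -> within D F --> within D' F)%classic.
Proof.
by move=> DD A; exact: (@filterS _ F FF _ _ (fun x h Dx => h (DD x Dx))).
Qed.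

Lemma cvg0_le_compl (R : realType) (T : Type) (F : set_system T)
    (FF : Filter F) (u v : T -> R) :
  (u @ F --> (1 : R))%classic -> (\forall x \near F, 0 <= v x <= 1 - u x) ->
  (v @ F --> (0 : R))%classic.
Proof.
move=> hu hv; apply: (squeeze_cvgr hv); first exact: cvg_cst.
by have := cvgB (cvg_cst (1 : R)) hu; rewrite subrr; exact.
Qed.

(** [E n] stands for the event that the certified bound is met. Comparing [f] with [y n] would give
    a test that contradicts the hypothesis. *)
Lemma no_separating_threshold (R : realType) d k (eta delta : R)
    (f : forall n, sgraph n -> rat) (E : forall n, pred (sgraph n))
    (r : rat) (scaled : bool) :
  eSBM_hypothesis R -> (0 < d)%N -> (2 <= k)%N -> - (k%:R - 1)^-1 <= eta ->
  eta <= 0 -> `|eta| < 2 * Num.sqrt (d%:R - 1) / d%:R ->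
  (1 - eta) * d%:R / k%:R \is a Num.int -> 0 < delta ->
  polytime enc_graph enc_rat f ->
  let y n := r * (if scaled then n%:R else 1) in
  (forall n (G : sgraph n), (0 < n)%N -> noisy_eSBM d k eta delta G != 0 ->
     y n < f n G) ->
  (forall n (G : sgraph n), (0 < n)%N -> E n G -> f n G < y n) ->
  ~ ((fun n => Pr (@Gnd R d n) (E n)) @ within (Gnd_defined d) \oo
       --> (1 : R))%classic.
Proof.
move=> hyp d0 k2 eta_ge eta_le eta_lt hint delta_gt0 hf y hP hQ hE.
have encP n (x : sgraph n) : exists w, enc_graph x = nseq n true ++ false :: w.
  by rewrite /enc_graph /enc_mx; eexists.
have [t t_poly ht] := polytime_compare r scaled encP hf.
have eta_ge1 : -1 <= eta.
  have : 2 <= k%:R :> R by rewrite ler_nat.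
  by move=> h; apply: le_trans eta_ge; rewrite lerN2 invf_le1; lra.
have eta_le1 : eta <= 1 by apply: le_trans eta_le _.
apply: (hyp delta k d eta delta_gt0 k2 eta_ge eta_le1
  (lt_dKS d0 eta_ge1 eta_le eta_lt) hint).
exists t; split=> //; rewrite /distinguishes.
set D := (_ `&` _)%classic.
have {}hE : ((fun n => Pr (@Gnd R d n) (E n)) @ within D \oo
    --> (1 : R))%classic.
  by apply: cvg_trans (cvg_app _ _) hE; apply: within_subset => n [].
apply: cvg0_le_compl hE _.
rewrite near_withinE; apply: nearW => n [_ [_ dn]].
have n0 : (0 < n)%N by apply: leq_ltn_trans dn.
(* On the support of the noisy law the test never errs. *)
have -> : Pr (noisy_eSBM d k eta delta (n := n)) [pred G | t n G == verdict_q] = 0.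
  apply: big1 => G /eqP tq; apply/eqP/negPn/negP => /(hP n G n0)/(ht n G).1.
  by rewrite tq.
rewrite add0r sumr_ge0 => [|G _]; last exact: Gnd_ge0.
(* On [E n] the test answers [verdict_q], so the error event under [Gnd] is disjoint from [E n]. *)
rewrite lerBrDl; apply: le_trans (Pr_Gnd_leq1 R d n).
rewrite /Pr [leRHS](bigID (E n)) /= lerD2l big_mkcond [leRHS]big_mkcond.
apply: ler_sum => G _; case: (boolP (E n G)) => hG /=.
  by have /negbTE -> := (ht n G).2 (hQ n G n0 hG).
by case: ifP => // _; apply: Gnd_ge0.
Qed.

Lemma map_adjmx (R : realType) n (G : sgraph n) :
  map_mx ratr (adjmx rat G) = adjmx R G.
Proof. by apply/matrixP => i j; rewrite !mxE ratr_nat. Qed.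

Theorem theorem2p6 (R : realType) (d k : nat) (eta : R) :
  eSBM_hypothesis R ->
  (0 < d)%N -> (2 <= k)%N ->
  - (k%:R - 1)^-1 <= eta -> eta <= 0 ->
  `|eta| < 2 * Num.sqrt (d%:R - 1) / d%:R ->
  (1 - eta) * d%:R / k%:R \is a Num.int ->
  forall eps : R, 0 < eps ->
    (~ exists A : forall n, 'M[R]_n -> R,
         polytime_mx A /\
         certifies_Gamma k (Gnd_defined d) (@Gnd R d)
           (fun n => n%:R * d%:R * (`|eta| - eps)) A)
    /\
    (~ exists A : forall n, sgraph n -> R,
         polytime_graph A /\
         certifies_MC k (Gnd_defined d) (@Gnd R d)
           (fun n => (k%:R - 1) / k%:R * (1 + `|eta| - eps)) A).
Proof.
move=> hyp d0 k2 eta_ge eta_le eta_lt hint eps eps_gt0.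
have d_gt0 : 0 < d%:R :> R by rewrite ltr0n.
have k_ge2 : 2 <= k%:R :> R by rewrite ler_nat.
have k0 : k%:R != 0 :> R by lra.
have k10 : k%:R - 1 != 0 :> R by lra.
have c_ge : 2^-1 <= (k%:R - 1) / k%:R :> R by rewrite ler_pdivlMr; lra.
have normE : `|eta| = - eta by rewrite ler0_norm.
split=> -[A [[f hf f_poly] [A_geq A_leq]]].
(* Since [k / (k - 1) <= 2], the noise lowers the bound on [Gamma] by at most [8 delta n], which is
   [n d eps / 2]; this leaves an interval of length [d eps / 2] for [r]. *)
- pose delta := d%:R * eps / 16.
  have delta_gt0 : 0 < delta by rewrite /delta divr_gt0 ?mulr_gt0.
  have [r] : exists r : rat,
      ratr r \in `]d%:R * (`|eta| - eps), d%:R * `|eta| - 8 * delta[%R.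
    by apply: rat_in_itvoo; rewrite /delta; nra.
  rewrite in_itv /= => /andP[r_gt r_lt].
  apply: (no_separating_threshold (f := fun n G => f n (adjmx rat G))
    (r := r) (scaled := true) hyp d0 k2 eta_ge eta_le eta_lt hint delta_gt0
    _ _ _ A_leq).
  (* [enc_graph] is the encoding of the adjacency matrix, so the same machine works. *)
  + by case: f_poly => M [c hM]; exists M, c => n G; apply: hM.
  + move=> n G n0 /(noisy_eSBM_cut k2 (ltW delta_gt0))[s [hE hcut]].
    have n_gt0 : 0 < n%:R :> R by rewrite ltr0n.
    rewrite -(ltr_rat R) rmorphM /= ratr_nat -hf map_adjmx.
    apply: lt_le_trans (A_geq n _); apply: lt_le_trans (Gamma_geq_cut R s G k2).
    apply: (@lt_le_trans _ _ (n%:R * (d%:R * `|eta| - 8 * delta))).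
      by rewrite mulrC ltr_pM2l.
    have hk : 0 <= k%:R / (k%:R - 1) :> R by rewrite divr_ge0; lra.
    have hk2 : k%:R / (k%:R - 1) <= 2 :> R by rewrite ler_pdivrMr; lra.
    have := ler_wpM2l hk hcut.
    have -> : k%:R / (k%:R - 1) * (n%:R * d%:R * ((k%:R - 1) / k%:R * (1 - eta))
        - 4 * delta * n%:R) = n%:R * d%:R * (1 - eta)
        - k%:R / (k%:R - 1) * (4 * delta * n%:R).
      by field; rewrite k0 k10.
    have : k%:R / (k%:R - 1) * (4 * delta * n%:R) <= 2 * (4 * delta * n%:R).
      by rewrite ler_wpM2r // !mulr_ge0 // ltW.
    rewrite normE; move: hE; lra.
  + move=> n G n0 /= hA; rewrite -(ltr_rat R) rmorphM /= ratr_nat -hf map_adjmx.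
    apply: le_lt_trans hA _; have n_gt0 : 0 < n%:R :> R by rewrite ltr0n.
    by rewrite -mulrA [ltRHS]mulrC ltr_pM2l.
- set c := (k%:R - 1) / k%:R in c_ge *.
  (* The second term keeps the loss [4 delta / d] below half the gap [c eps]. The first keeps it at
     most 1/4, while [c >= 1/2]: the planted cut is then nonempty, so the graph has an edge and the
     certificate applies. *)
  pose delta := Num.min (16^-1) (d%:R * c * eps / 8).
  have c_gt0 : 0 < c by apply: lt_le_trans c_ge; lra.
  have delta_gt0 : 0 < delta.
    rewrite lt_min; apply/andP; split; first lra.
    by apply: divr_gt0; [rewrite 2?mulr_gt0 | lra].
  have delta_le : delta <= 16^-1 by rewrite ge_min lexx.
  have delta_le' : 4 * delta / d%:R <= c * eps / 2.
    have : delta <= d%:R * c * eps / 8 by rewrite ge_min lexx orbT.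
    by rewrite ler_pdivrMr //; lra.
  have [r] : exists r : rat,
      ratr r \in `]c * (1 + `|eta| - eps), c * (1 + `|eta|) - 4 * delta / d%:R[%R.
    by apply: rat_in_itvoo; nra.
  rewrite in_itv /= => /andP[r_gt r_lt].
  apply: (no_separating_threshold (f := f)
    (r := r) (scaled := false) hyp d0 k2 eta_ge eta_le eta_lt hint delta_gt0
    f_poly _ _ A_leq).
  + move=> n G n0 /(noisy_eSBM_cut k2 (ltW delta_gt0))[s [hE hcut]].
    have n_gt0 : 0 < n%:R :> R by rewrite ltr0n.
    have cut_ge : n%:R * d%:R * (c * (1 + `|eta|) - 4 * delta / d%:R)
        <= (2 * #|cut_edges s G|)%N%:R.
      apply: le_trans hcut; rewrite normE -/c le_eqVlt; apply/orP; left.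
      by apply/eqP; field; lra.
    have rhs_gt0 : 0 < c * (1 + `|eta|) - 4 * delta / d%:R.
      have : 4 * delta / d%:R <= 4^-1.
        rewrite ler_pdivrMr //; have : 1 <= d%:R :> R by rewrite ler1n.
        lra.
      have := normr_ge0 eta; nra.
    have cut_gt0 : (0 < #|cut_edges s G|)%N.
      rewrite -(ltr0n R); move: cut_ge; rewrite natrM.
      have := mulr_gt0 (mulr_gt0 n_gt0 d_gt0) rhs_gt0; lra.
    have sub : (#|cut_edges s G| <= #|edges G|)%N.
      by apply/subset_leq_card/fintype.subsetP => e; rewrite inE => /andP[].
    have E_gt0 : (0 < #|edges G|)%N by apply: leq_trans sub.
    rewrite mulr1 -(ltr_rat R) -hf; apply: lt_le_trans (A_geq n G E_gt0).
    apply: lt_le_trans (MC_geq_cut R s G).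
    apply: lt_le_trans r_lt _; rewrite ler_pdivlMr ?ltr0n //.
    (* The noisy graph has at most [n d / 2] edges, and fewer edges only increase the cut
       fraction. *)
    have := ler_wpM2l (ltW rhs_gt0) hE; move: cut_ge; rewrite !natrM; lra.
  + move=> n G n0 /= hA; rewrite mulr1 -(ltr_rat R) -hf.
    exact: le_lt_trans hA _.
Qed.
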